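(* Let $(\mathcal S,\gamma)$ be an IFS arc in $\mathbb{R}^n$. Then $\gamma$ has bounded turning if and only if both of the following hold: (1) there exist constants $r_0>0$ and $C_1,C_2>0$ such that for every open set $U\subseteq\mathbb{R}^n$ with $U\cap\gamma\neq\emptyset$ and $0<\operatorname{diam}(U\cap\gamma)<r_0$ there is a map $\varphi:U\cap\gamma\to\gamma$ with $$\frac{C_1|a-b|}{\operatorname{diam}(U\cap\gamma)}\le|\varphi(a)-\varphi(b)|\le\frac{C_2|a-b|}{\operatorname{diam}(U\cap\gamma)}\quad\text{for all }a,b\in U\cap\gamma;$$ (2) there exist constants $r_1>0$ and $C_3>0$ such that for every $x\in\gamma$ and $0<r<r_1$ there is a map $\psi:\gamma\to B(x,r)\cap\gamma$ with $|\psi(a)-\psi(b)|\ge C_3\,r\,|a-b|$ for all $a,b\in\gamma$.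
   Context: $\mathcal S=\{S_1,\dots,S_N\}$, $N\ge2$, contracting similarities of $\mathbb{R}^n$, invariant set $\gamma$ (unique nonempty compact set with $\gamma=\bigcup_iS_i(\gamma)$). IFS path: there are $a,b$ with $S_1(a)=a$, $S_N(b)=b$, $S_i(b)=S_{i+1}(a)$ for $i=1,\dots,N-1$. IFS arc: moreover $S_i(\gamma)\cap S_{i+1}(\gamma)=\{S_{i+1}(a)\}$ for $i=1,\dots,N-1$ and $S_i(\gamma)\cap S_j(\gamma)=\emptyset$ for $i,j\in\{1,\dots,N\}$, $|i-j|>1$. $\gamma$ has bounded turning if there is $C\ge1$ such that any distinct $p,q\in\gamma$ lie in a continuum $E\subseteq\gamma$ with $\operatorname{diam}E\le C|p-q|$. $B(x,r)$ is the open Euclidean ball. *)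

(* Defs.v *)
(* Points of R^n are row vectors 'rV[R]_n; the
   topology (open, compact, connected) is the library's (product topology,
   equal to the Euclidean one); distances are Euclidean, defined below. *)
From HB Require Import structures.
From mathcomp Require Import all_boot all_order all_algebra.
From mathcomp Require Import all_classical all_reals all_analysis.
Set Implicit Arguments. Unset Strict Implicit. Unset Printing Implicit Defensive.
Import Order.TTheory GRing.Theory Num.Theory.
Import numFieldNormedType.Exports.
Local Open Scope classical_set_scope.
Local Open Scope ring_scope.

Definition eucl_dist (R : realType) (n : nat) (x y : 'rV[R]_n) : R :=
  Num.sqrt (\sum_(i < n) (x ord0 i - y ord0 i) ^+ 2).

(* diameter of a set (used only for bounded sets; sup of empty set is 0) *)
Definition diam (R : realType) (n : nat) (A : set 'rV[R]_n) : R :=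
  sup [set eucl_dist x y | x in A & y in A].

Definition eball (R : realType) (n : nat) (x : 'rV[R]_n) (r : R) : set 'rV[R]_n :=
  [set y | eucl_dist x y < r].

Definition contr_similarity (R : realType) (n : nat) (f : 'rV[R]_n -> 'rV[R]_n) :=
  exists c : R, 0 < c /\ c < 1 /\ forall x y, eucl_dist (f x) (f y) = c * eucl_dist x y.

(* The maps are indexed S 0, ..., S (N-1) (paper: S_1,...,S_N).
   gamma is the invariant set: nonempty compact with gamma = U_i S_i(gamma). *)
Definition IFS_invariant (R : realType) (n N : nat)
  (S : nat -> 'rV[R]_n -> 'rV[R]_n) (gamma : set 'rV[R]_n) :=
  [/\ (2 <= N)%N, (forall i, (i < N)%N -> contr_similarity (S i)),
      compact gamma, gamma !=set0 &
      gamma = \bigcup_(i in [set i | (i < N)%N]) (S i @` gamma)].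

Definition IFS_arc (R : realType) (n N : nat)
  (S : nat -> 'rV[R]_n -> 'rV[R]_n) (gamma : set 'rV[R]_n) :=
  IFS_invariant N S gamma /\
  exists a b : 'rV[R]_n,
    [/\ S 0%N a = a, S N.-1 b = b,
        (forall i, (i.+1 < N)%N -> S i b = S i.+1 a),
        (forall i, (i.+1 < N)%N -> S i @` gamma `&` S i.+1 @` gamma = [set S i.+1 a]) &
        (forall i j, (i < N)%N -> (j < N)%N -> (i.+1 < j)%N \/ (j.+1 < i)%N ->
           S i @` gamma `&` S j @` gamma = set0)].

Definition continuum (R : realType) (n : nat) (E : set 'rV[R]_n) :=
  compact E /\ connected E /\ E !=set0.

Definition bounded_turning (R : realType) (n : nat) (gamma : set 'rV[R]_n) :=
  exists C : R, 1 <= C /\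
    forall p q, gamma p -> gamma q -> p <> q ->
      exists E, [/\ E `<=` gamma, continuum E, E p, E q &
                    diam E <= C * eucl_dist p q].

(* Main.v *)
Require Import Defs.
From HB Require Import structures.
From mathcomp Require Import all_boot all_order all_algebra.
From mathcomp Require Import all_classical all_reals all_analysis.
From mathcomp Require Import ring lra zify.
Import Order.TTheory GRing.Theory Num.Theory.
Import numFieldNormedType.Exports.
Local Open Scope classical_set_scope.
Local Open Scope ring_scope.

(* Everything goes through junction separation: for u in S_i(gamma), v in
   S_{i+1}(gamma) and x = S_i(b) = S_{i+1}(a), the distance |u - v| is bounded
   below by a constant times |u - x| + |v - x|.

   Bounded turning gives it because a continuum joining u to v in the arc gamma
   passes through x.  Conversely, by self-similarity two points of gamma may be
   assumed to lie in different first level pieces; if these are disjoint gamma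
   itself is short enough, and if they are adjacent one joins each point to x by
   a small copy of gamma with endpoint x.

   Condition (1) gives it because for u, v close to x, compared with the scale
   s = |u - x| + |v - x| of a ball about x, the map phi sends small copies of
   gamma joining u and v to x onto subcontinua of gamma of size about 1 meeting
   only at phi(x), so that phi(x) lies between phi(u) and phi(v) on the arc and
   |phi(u) - phi(v)| is bounded below.  Conversely, a subset of gamma lies after
   rescaling either in no small neighbourhood of a junction, where the identity
   works, or near one, where both sides are blown up by the similarities fixing
   b and a.  Condition (2) holds for every such gamma by self-similarity. *)

(** * Euclidean distance *)

Section EuclideanDistance.
Context {R : realType} {n : nat}.
Implicit Types (x y z : 'rV[R]_n) (A B E : set 'rV[R]_n).
Local Notation d := (@eucl_dist R n).

Lemma eucl_dist_ge0 x y : 0 <= d x y.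
Proof. exact: sqrtr_ge0. Qed.

Lemma eucl_distxx x : d x x = 0.
Proof. by rewrite /eucl_dist big1 ?sqrtr0 // => i _; rewrite subrr expr0n. Qed.

Lemma eucl_distC x y : d x y = d y x.
Proof. by congr Num.sqrt; apply: eq_bigr => i _; rewrite -sqrrN opprB. Qed.

Lemma sqr_eucl_dist x y : d x y ^+ 2 = \sum_(i < n) (x ord0 i - y ord0 i) ^+ 2.
Proof. by rewrite sqr_sqrtr // sumr_ge0 // => i _; rewrite sqr_ge0. Qed.

Lemma ler_coord_eucl_dist x y i : `|x ord0 i - y ord0 i| <= d x y.
Proof.
rewrite -(@ler_pXn2r _ 2) ?nnegrE ?eucl_dist_ge0 // real_normK ?num_real //.
rewrite sqr_eucl_dist (bigD1 i) //= lerDl sumr_ge0 // => j _.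
by rewrite sqr_ge0.
Qed.

Lemma eucl_dist_eq0 x y : d x y = 0 -> x = y.
Proof.
move=> d0; apply/rowP => i; apply/eqP; rewrite -subr_eq0 -normr_le0.
by rewrite -d0 ler_coord_eucl_dist.
Qed.

Lemma cauchy_schwarz_sum (u v : 'I_n -> R) :
  (\sum_i u i * v i) ^+ 2 <= (\sum_i u i ^+ 2) * (\sum_i v i ^+ 2).
Proof.
(* Lagrange's identity: this double sum is twice the defect in the inequality. *)
have : 0 <= \sum_i \sum_j (u i * v j - u j * v i) ^+ 2.
  by do 2!(apply: sumr_ge0 => ? _); rewrite sqr_ge0.
suff -> : \sum_i \sum_j (u i * v j - u j * v i) ^+ 2 =
    2 * ((\sum_i u i ^+ 2) * (\sum_i v i ^+ 2) - (\sum_i u i * v i) ^+ 2).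
  by rewrite pmulr_rge0 // subr_ge0.
rewrite mulrBr mulr_natl mulr2n [X in _ + X - _]mulrC expr2 !big_distrlr /=.
rewrite mulr_sumr -big_split -sumrB; apply: eq_bigr => i _.
rewrite mulr_sumr -big_split -sumrB; apply: eq_bigr => j _ /=.
by ring.
Qed.

Lemma eucl_dist_triangle y x z : d x z <= d x y + d y z.
Proof.
have dd0 : 0 <= d x y + d y z by rewrite addr_ge0 ?eucl_dist_ge0.
rewrite -(@ler_pXn2r _ 2) ?nnegrE ?eucl_dist_ge0 // sqrrD !sqr_eucl_dist.
set P := \sum_i (x ord0 i - y ord0 i) * (y ord0 i - z ord0 i).
have -> : \sum_i (x ord0 i - z ord0 i) ^+ 2 = \sum_i (x ord0 i - y ord0 i) ^+ 2
    + P *+ 2 + \sum_i (y ord0 i - z ord0 i) ^+ 2.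
  rewrite /P -sumrMnl -!big_split; apply: eq_bigr => i _ /=; ring.
rewrite lerD2r lerD2l lerMn2r /=; apply: le_trans (ler_norm _) _.
rewrite -(@ler_pXn2r _ 2) ?nnegrE ?mulr_ge0 ?eucl_dist_ge0 //.
by rewrite real_normK ?num_real // exprMn !sqr_eucl_dist cauchy_schwarz_sum.
Qed.

(** The library topology comes from the sup norm; this bound and the next turn its neighbourhoods
    into Euclidean balls. *)
Lemma eucl_dist_le_mx_norm x y : d x y <= Num.sqrt n%:R * `|x - y|.
Proof.
rewrite -(@ler_pXn2r _ 2) ?nnegrE ?mulr_ge0 ?sqrtr_ge0 ?eucl_dist_ge0 //.
rewrite exprMn sqr_eucl_dist sqr_sqrtr ?ler0n //.
rewrite mulr_natl -[X in _ *+ X](card_ord n) -sumr_const ler_sum // => i _.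
rewrite -real_normK ?num_real // lerXn2r ?nnegrE //.
have -> : x ord0 i - y ord0 i = (x - y) ord0 i by rewrite !mxE.
by rewrite [leRHS]/Num.norm /= mx_normrE (le_bigmax _ _ (ord0, i)).
Qed.

Lemma mx_norm_le_eucl_dist x y : `|x - y| <= d x y.
Proof.
rewrite [leLHS]/Num.norm /= mx_normrE; apply: bigmax_le => [|[i j] _].
  exact: eucl_dist_ge0.
by rewrite /= !mxE ord1 ler_coord_eucl_dist.
Qed.

Lemma nbhs_eball x e : 0 < e -> nbhs x (eball x e).
Proof.
move=> e0; have K0 : 0 < Num.sqrt n%:R + 1 :> R by rewrite ltr_wpDl ?sqrtr_ge0.
apply/nbhs_ballP; exists (e / (Num.sqrt n%:R + 1)) => /=; first exact: divr_gt0.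
move=> y; rewrite -ball_normE /ball_ /= ltr_pdivlMr // => xy.
apply: le_lt_trans (eucl_dist_le_mx_norm x y) (le_lt_trans _ xy).
by rewrite mulrDr mulr1 mulrC lerDl.
Qed.

Lemma nbhs_eballP x (A : set 'rV[R]_n) :
  nbhs x A <-> exists2 e, 0 < e & eball x e `<=` A.
Proof.
split=> [/nbhs_ballP[e e0 eA]|[e e0 eA]]; last exact: filterS (nbhs_eball x e e0).
exists e => // y xy; apply: eA; rewrite -ball_normE /ball_ /=.
exact: le_lt_trans (mx_norm_le_eucl_dist x y) xy.
Qed.

Lemma eball_open x e : open (eball x e).
Proof.
rewrite openE => y xy; apply/nbhs_eballP; exists (e - d x y).
  by rewrite subr_gt0.
move=> z yz; rewrite /eball /=; have := eucl_dist_triangle y x z.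
rewrite /eball /= in yz; lra.
Qed.

Lemma similarity_continuous c (f : 'rV[R]_n -> 'rV[R]_n) :
  0 < c -> (forall x y, d (f x) (f y) = c * d x y) -> continuous f.
Proof.
move=> c0 fc x A /nbhs_eballP[e e0 eA]; apply/nbhs_eballP.
exists (e / c); first exact: divr_gt0.
move=> y; rewrite /eball /= ltr_pdivlMr // mulrC -fc => xy; exact: eA.
Qed.

Lemma eucl_dist_continuous : continuous (fun p : 'rV[R]_n * 'rV[R]_n => d p.1 p.2).
Proof.
move=> [u v]; apply/cvgrPdist_lt => e e0.
have e2 : 0 < e / 2 by rewrite divr_gt0.
exists (eball u (e / 2), eball v (e / 2)).
  by split; exact: nbhs_eball.
move=> [u' v'] /= [uu vv]; rewrite /eball /= in uu vv.
have := eucl_dist_triangle u' u v; have := eucl_dist_triangle v' u' v.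
have := eucl_dist_triangle u u' v'; have := eucl_dist_triangle v u v'.
rewrite [d u' u]eucl_distC [d v' v]eucl_distC => *.
rewrite /= ltr_norml; apply/andP; split; lra.
Qed.

(** The distance attains its minimum on the compact product, and a minimum of zero would give a
    common point. *)
Lemma compact_disjoint_dist A B : compact A -> compact B -> A `&` B = set0 ->
  exists2 e, 0 < e & forall u v, A u -> B v -> e <= d u v.
Proof.
move=> cA cB AB0.
have [AB|/set0P/negP/negPn/eqP AB] := pselect (A `*` B !=set0); last first.
  exists 1 => // u v Au Bv; suff : (A `*` B) (u, v) by rewrite AB.
  by split.
have cd := continuous_subspaceT eucl_dist_continuous.
have [[u v]] := compact_EVT_min AB (compact_setX cA cB) (@cd _).
move=> /set_mem[/= Au Bv] uv; exists (d u v).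
  rewrite lt_neqAle eucl_dist_ge0 andbT eq_sym; apply/eqP => /eucl_dist_eq0 uv0.
  suff : (A `&` B) u by rewrite AB0.
  by split=> //; rewrite uv0.
by move=> u' v' Au' Bv'; apply: (uv (u', v')); rewrite inE.
Qed.

Lemma eucl_compact_bounded A : compact A ->
  exists2 M, 0 < M & forall x y, A x -> A y -> d x y < M.
Proof.
move=> cA; have [A0|/set0P/negP/negPn/eqP A0] := pselect (A `*` A !=set0); last first.
  exists 1 => // x y Ax Ay; suff : (A `*` A) (x, y) by rewrite A0.
  by split.
have cd := continuous_subspaceT eucl_dist_continuous.
have [[u v]] := compact_EVT_max A0 (compact_setX cA cA) (@cd _).
move=> _ uv; exists (d u v + 1); first by rewrite ltr_wpDl ?eucl_dist_ge0.
move=> x y Ax Ay; have := uv (x, y); rewrite inE => /(_ (conj Ax Ay)) /= ?; lra.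
Qed.

(** Explicit moduli pass directly to subsets and to compositions with Lipschitz maps. *)
Definition eucl_unif_continuous_on E (g : 'rV[R]_n -> R) :=
  forall e, 0 < e -> exists2 k, 0 < k &
    forall x y, E x -> E y -> d x y < k -> `|g x - g y| < e.

Lemma connected_ivt E g u v t : connected E -> eucl_unif_continuous_on E g ->
  E u -> E v -> g u <= t <= g v -> exists2 w, E w & g w = t.
Proof.
move=> cE gE Eu Ev t_uv.
have /(connected_continuous_connected cE)/connected_intervalP gi :
    {within E, continuous g}.
  apply/subspace_continuousP => x Ex; apply/cvgrPdist_lt => e e0.
  have [k k0 gk] := gE _ e0; apply/nbhs_eballP; exists k => // y xy Ey.
  exact: gk.
have [] := gi _ _ (imageP g Eu) (imageP g Ev) t t_uv.
by move=> w Ew <-; exists w.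
Qed.

(* The intervals [g(E1)] and [g(E2)] meet only at [g x], so they lie on
   opposite sides of it. *)
Lemma connected_between E1 E2 g x u v : connected E1 -> connected E2 ->
  eucl_unif_continuous_on E1 g -> eucl_unif_continuous_on E2 g ->
  E1 x -> E2 x -> E1 u -> E2 v ->
  (forall e1 e2, E1 e1 -> E2 e2 -> g e1 = g e2 -> g e1 = g x) ->
  g u <= g x <= g v \/ g v <= g x <= g u.
Proof.
move=> c1 c2 g1 g2 x1 x2 u1 v2 inj.
have [ux|xu] := lerP (g u) (g x); have [vx|xv] := lerP (g v) (g x).
- have [uv|/ltW vu] := lerP (g u) (g v).
    have [] := connected_ivt E1 g u x (g v) c1 g1 u1 x1; first by rewrite uv vx.
    by move=> w Ew gw; have := inj _ _ Ew v2 gw; lra.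
  have [] := connected_ivt E2 g v x (g u) c2 g2 v2 x2; first by rewrite vu ux.
  by move=> w Ew gw; have := inj _ _ u1 Ew (esym gw); lra.
- by left; lra.
- by right; lra.
- have [uv|/ltW vu] := lerP (g u) (g v).
    have [] := connected_ivt E2 g x v (g u) c2 g2 x2 v2; first by lra.
    by move=> w Ew gw; have := inj _ _ u1 Ew (esym gw); lra.
  have [] := connected_ivt E1 g x u (g v) c1 g1 x1 u1; first by lra.
  by move=> w Ew gw; have := inj _ _ Ew v2 gw; lra.
Qed.

Lemma diam_ub A M : (forall x y, A x -> A y -> d x y <= M) ->
  forall x y, A x -> A y -> d x y <= diam A.
Proof.
move=> AM x y Ax Ay; apply: ub_le_sup; last by exists x => //; exists y.
by exists M => _ [u Au [v Av <-]]; exact: AM.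
Qed.

Lemma diam_le A M : A !=set0 -> (forall x y, A x -> A y -> d x y <= M) ->
  diam A <= M.
Proof.
move=> [x Ax] AM; apply: ge_sup; first by exists (d x x); exists x => //; exists x.
by move=> _ [u Au [v Av <-]]; exact: AM.
Qed.

Lemma diam_half A M : (forall x y, A x -> A y -> d x y <= M) -> 0 < diam A ->
  exists x y, [/\ A x, A y & diam A <= 2 * d x y].
Proof.
move=> AM dA.
have hs : has_sup [set d x y | x in A & y in A].
  by apply: contrapT => /sup_out s0; move: dA; rewrite /diam s0 ltxx.
have dA2 : 0 < diam A / 2 by rewrite divr_gt0.
have [_ [x Ax [y Ay <-]]] := sup_adherent dA2 hs.
rewrite -/(diam A) => h; exists x, y; split => //; lra.
Qed.

End EuclideanDistance.

(** * Uniform thresholds and induction on scale *)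

Lemma finite_uniform {R : realType} N (P : nat -> R -> Prop) :
  (forall i e k, P i e -> 0 < k -> k <= e -> P i k) ->
  (forall i, (i < N)%N -> exists2 e, 0 < e & P i e) ->
  exists2 e, 0 < e & forall i, (i < N)%N -> P i e.
Proof.
move=> mono; elim: N => [|N IH] H; first by exists 1.
have [e e0 eP] := IH (fun i iN => H i (ltnW iN)).
have [k k0 kP] := H N (ltnSn N).
have m0 : 0 < Num.min e k by rewrite lt_min e0.
exists (Num.min e k) => // i; rewrite ltnS leq_eqVlt => /orP[/eqP->|iN].
  by apply: mono kP _ _; rewrite // ge_min lexx orbT.
by apply: mono (eP i iN) _ _; rewrite // ge_min lexx.
Qed.

Lemma exprn_cvg_small {R : realType} (c M e : R) : 0 < c -> c < 1 -> 0 < e ->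
  exists m, M * c ^+ m < e.
Proof.
move=> c0 c1 e0; have [M0|M0] := lerP M 0.
  by exists 0%N; rewrite expr0 mulr1; exact: le_lt_trans e0.
have : (fun m => c ^+ m) @ \oo --> (0 : R) by apply: cvg_expr; rewrite gtr0_norm.
move=> /cvgrPdist_lt/(_ _ (divr_gt0 e0 M0))[m _ /(_ m (leqnn m))].
rewrite sub0r normrN gtr0_norm ?exprn_gt0 // ltr_pdivlMr // mulrC => h.
by exists m.
Qed.

(** Each step from [t] to an [s] with [t <= c * s] enlarges the scale by a factor at least [c^-1],
    so [delta] is reached after boundedly many steps, and there [P] is proved directly. This
    replaces induction on the depth of pieces. *)
Lemma scale_ind {R : realType} (c delta : R) (P : R -> Prop) :
  0 < c -> c < 1 -> 0 < delta ->
  (forall t, 0 < t -> (t < delta -> forall s, t <= c * s -> P s) -> P t) ->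
  forall t, 0 < t -> P t.
Proof.
move=> c0 c1 d0 H t t0.
have [m] := exprn_cvg_small _ delta _ c0 c1 t0.
elim: m t t0 => [|m IH] t t0 tm.
  by apply: H => // td; rewrite expr0 mulr1 in tm; lra.
apply: H => // td s ts; have s0 : 0 < s by rewrite -(pmulr_rgt0 _ c0); lra.
apply: IH => //; rewrite -(ltr_pM2l c0); apply: lt_le_trans ts.
by rewrite mulrCA -exprS.
Qed.

(** * Constants of an IFS arc *)

Lemma similarity_injective {R : realType} {n : nat} {c : R}
    {f : 'rV[R]_n -> 'rV[R]_n} : 0 < c ->
  (forall x y, eucl_dist (f x) (f y) = c * eucl_dist x y) -> injective f.
Proof.
move=> c0 fc x y fxy; apply: eucl_dist_eq0; apply: (mulfI (lt0r_neq0 c0)).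
by rewrite -fc fxy eucl_distxx mulr0.
Qed.

(** The orbit of a point of [A] under [f] stays in [A] and converges geometrically to [p]. *)
Lemma contraction_fixpoint_mem {R : realType} {n : nat} {c : R}
    {f : 'rV[R]_n -> 'rV[R]_n} {A : set 'rV[R]_n} {p : 'rV[R]_n} :
  0 < c -> c < 1 -> (forall x y, eucl_dist (f x) (f y) = c * eucl_dist x y) ->
  closed A -> A !=set0 -> (forall x, A x -> A (f x)) -> f p = p -> A p.
Proof.
move=> c0 c1 fc clA [y Ay] fA fp; apply: contrapT => nAp.
have : nbhs p (~` A) by apply: open_nbhs_nbhs; split => //; exact: closed_openC.
move=> /nbhs_eballP[e e0 pA].
have [m me] := exprn_cvg_small c (eucl_dist p y) e c0 c1 e0.
have dm k : eucl_dist p (iter k f y) = eucl_dist p y * c ^+ k.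
  elim: k => [|k IH]; first by rewrite expr0 mulr1.
  by rewrite iterS -[in LHS]fp fc IH exprS mulrCA.
apply: (pA (iter m f y)); first by rewrite /eball /= dm.
by elim: m {me} => //= m; exact: fA.
Qed.

(* [D] bounds the diameter of [gamma]; [delta] is below the distance of
   disjoint first level pieces, and below the distance of each endpoint to the
   pieces not containing it. *)
Record arc_data {R : realType} {n N : nat}
    {S : nat -> 'rV[R]_n -> 'rV[R]_n} {gamma : set 'rV[R]_n}
    {a b : 'rV[R]_n} {c : nat -> R} {cmin cmax D delta : R} : Prop := ArcData {
  arc_N : (2 <= N)%N;
  cmin_gt0 : 0 < cmin;
  cmax_lt1 : cmax < 1;
  c_bounds : forall i, (i < N)%N -> cmin <= c i <= cmax;
  distS : forall i x y, (i < N)%N ->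
    eucl_dist (S i x) (S i y) = c i * eucl_dist x y;
  arc_compact : compact gamma;
  arcS : forall i x, (i < N)%N -> gamma x -> gamma (S i x);
  arcE : forall x, gamma x -> exists i z, [/\ (i < N)%N, gamma z & x = S i z];
  Sa : S 0%N a = a;
  Sb : S N.-1 b = b;
  Sab : forall i, (i.+1 < N)%N -> S i b = S i.+1 a;
  arc_a : gamma a;
  arc_b : gamma b;
  arc_neq : a <> b;
  pieces_meet : forall i j z w, (i < j)%N -> (j < N)%N -> gamma z -> gamma w ->
    S i z = S j w -> [/\ j = i.+1, z = b & w = a];
  D_gt0 : 0 < D;
  arc_diam : forall x y, gamma x -> gamma y -> eucl_dist x y < D;
  delta_gt0 : 0 < delta;
  pieces_far : forall i j z w, (i.+1 < j)%N -> (j < N)%N -> gamma z -> gamma w ->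
    delta <= eucl_dist (S i z) (S j w);
  a_far : forall i z, (i < N)%N -> gamma z -> i <> 0%N ->
    delta <= eucl_dist (S i z) a;
  b_far : forall i z, (i < N)%N -> gamma z -> i <> N.-1 ->
    delta <= eucl_dist (S i z) b }.

Lemma IFS_arc_data {R : realType} {n N : nat}
    {S : nat -> 'rV[R]_n -> 'rV[R]_n} {gamma : set 'rV[R]_n} :
  IFS_arc N S gamma -> (exists a, gamma = [set a]) \/
  exists a b c cmin cmax D delta, @arc_data R n N S gamma a b c cmin cmax D delta.
Proof.
move=> [[N2 contr cg g0 gU] [a [b [Sa Sb Sab meet1 meet0]]]].
have /choice[c cP] : forall i, exists k, (i < N)%N -> 0 < k /\ k < 1 /\
    forall x y, eucl_dist (S i x) (S i y) = k * eucl_dist x y.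
  move=> i; have [iN|] := boolP (i < N)%N; last by exists 0.
  by have [k kP] := contr i iN; exists k.
have c_gt0 i : (i < N)%N -> 0 < c i by move=> /cP[].
have c_lt1 i : (i < N)%N -> c i < 1 by move=> /cP[_ []].
have dS i x y : (i < N)%N -> eucl_dist (S i x) (S i y) = c i * eucl_dist x y.
  by move=> /cP[_ []].
have N0 : (0 < N)%N by lia.
have N1 : (N.-1 < N)%N by lia.
have gS i x : (i < N)%N -> gamma x -> gamma (S i x).
  by move=> iN gx; rewrite gU; exists i => //; exists x.
have gE x : gamma x -> exists i z, [/\ (i < N)%N, gamma z & x = S i z].
  by rewrite {1}gU => -[i /= iN [z gz <-]]; exists i, z.
have clg : closed gamma by exact: compact_closed (@norm_hausdorff _ _) cg.
have ga : gamma a.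
  by apply: (contraction_fixpoint_mem (c_gt0 0%N N0) _ _ clg g0 _ Sa);
    [exact: c_lt1|move=> x y; exact: dS|move=> x; exact: gS].
have gb : gamma b.
  by apply: (contraction_fixpoint_mem (c_gt0 _ N1) _ _ clg g0 _ Sb);
    [exact: c_lt1|move=> x y; exact: dS|move=> x; exact: gS].
have Sinj i : (i < N)%N -> injective (S i).
  by move=> iN; apply: similarity_injective (c_gt0 i iN) _ => x y; exact: dS.
have Sm i : (i < N)%N -> compact (S i @` gamma).
  move=> iN; apply: continuous_compact => //; apply: continuous_subspaceT.
  by apply: similarity_continuous (c_gt0 i iN) _ => x y; exact: dS.
have [cmin cmin0 cminP] : exists2 e, 0 < e & forall i, (i < N)%N -> e <= c i.
  apply: (@finite_uniform R N (fun i e => e <= c i)).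
    by move=> i e k ec _ ke; exact: le_trans ec.
  by move=> i iN; exists (c i) => //; exact: c_gt0.
have [cM cM0 cMP] : exists2 e, 0 < e & forall i, (i < N)%N -> e <= 1 - c i.
  apply: (@finite_uniform R N (fun i e => e <= 1 - c i)).
    by move=> i e k ec _ ke; exact: le_trans ec.
  by move=> i iN; exists (1 - c i) => //; rewrite subr_gt0; exact: c_lt1.
have [D D0 gD] := eucl_compact_bounded _ cg.
(* If [a = b], the junction equations make every map fix [a]; descending [m] levels from any [y]
   bounds its distance to [a] by [D * (1 - cM) ^+ m], so [gamma] is one point. *)
have [ab|ab] := pselect (a = b).
  left; exists a; apply/seteqP; split => [y gy|y ->//] /=.
  have Sja i : (i < N)%N -> S i a = a.
    elim: i => // i IH iN; rewrite -Sab // -ab; apply: IH; lia.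
  apply: eucl_dist_eq0; apply/eqP; rewrite eq_le eucl_dist_ge0 andbT.
  rewrite leNgt; apply/negP => d0.
  have cM1 : 0 < 1 - cM.
    by have := c_gt0 _ N0; have := cMP _ N0; lra.
  have [|m] := exprn_cvg_small (1 - cM) D (eucl_dist y a) cM1 _ d0.
    by lra.
  rewrite ltNge => /negP; apply.
  elim: m y gy {d0} => [|m IH] y gy.
    by rewrite expr0 mulr1 ltW // gD.
  have [i [z [iN gz ->]]] := gE y gy.
  rewrite -(Sja i iN) dS // exprS mulrCA; apply: ler_pM => //.
  - by rewrite ltW // c_gt0.
  - exact: eucl_dist_ge0.
  - by have := cMP _ iN; lra.
  - exact: IH.
right.
have meet i j z w : (i < j)%N -> (j < N)%N -> gamma z -> gamma w ->
    S i z = S j w -> [/\ j = i.+1, z = b & w = a].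
  move=> ij jN gz gw zw.
  have pz : (S i @` gamma `&` S j @` gamma) (S i z).
    by split; [exists z|rewrite zw; exists w].
  have [ji|ji] := ltnP i.+1 j.
    by move: pz; rewrite meet0 //; [lia|left].
  have {}ji : j = i.+1 by lia.
  subst j; move: pz; rewrite meet1 //= => pz; split => //.
    by apply: (Sinj i); [lia|rewrite Sab].
  by apply: (Sinj i.+1); [lia|rewrite -zw].
have [dl1 dl10 far1] : exists2 e, 0 < e & forall i, (i < N)%N ->
    forall j z w, (j < N)%N -> (i.+1 < j)%N -> gamma z -> gamma w ->
    e <= eucl_dist (S i z) (S j w).
  apply: finite_uniform.
    by move=> i e k H _ ke j z w jN ij gz gw; apply: le_trans ke (H _ _ _ _ _ _ _).
  move=> i iN.
  have [e e0 eP] : exists2 e, 0 < e & forall j, (j < N)%N ->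
      forall z w, (i.+1 < j)%N -> gamma z -> gamma w ->
      e <= eucl_dist (S i z) (S j w).
    apply: finite_uniform.
      by move=> j e k H _ ke z w ij gz gw; apply: le_trans ke (H _ _ _ _ _).
    move=> j jN; have [ij|] := boolP (i.+1 < j)%N; last by exists 1.
    have [|e e0 eP] := compact_disjoint_dist _ _ (Sm i iN) (Sm j jN).
      by apply: meet0 => //; left.
    by exists e => // z w _ gz gw; apply: eP; [exists z|exists w].
  by exists e => // j z w jN ij; exact: eP.
have end_far p k : (k < N)%N -> (forall i z, (i < N)%N -> gamma z -> i <> k ->
    S i z <> p) -> exists2 e, 0 < e & forall i, (i < N)%N ->
    forall z, gamma z -> i <> k -> e <= eucl_dist (S i z) p.
  move=> kN kP; apply: finite_uniform.
    by move=> i e h H _ he z gz ik; apply: le_trans he (H _ _ _).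
  move=> i iN; have [->|/eqP ik] := eqVneq i k; first by exists 1.
  have [|e e0 eP] := compact_disjoint_dist _ _ (Sm i iN) (@compact_set1 _ p).
    by apply/seteqP; split => // _ [[z gz <-] /= zp]; exact: kP zp.
  by exists e => // z gz _; apply: eP => //; exists z.
have [|dla dla0 fara] := end_far a 0%N N0.
  move=> i z iN gz i0 zp.
  by have [||_ /ab] := meet 0%N i a z _ iN ga gz; [lia|rewrite Sa zp|].
have [|dlb dlb0 farb] := end_far b N.-1 N1.
  move=> i z iN gz i0 zp.
  by have [||_ _ /esym/ab] := meet i N.-1 z b _ N1 gz gb; [lia|rewrite Sb zp|].
exists a, b, c, cmin, (1 - cM), D, (Num.min dl1 (Num.min dla dlb)).
split => //.
- by rewrite gtrBl.
- by move=> i iN; rewrite cminP //=; have := cMP _ iN; lra.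
- by rewrite !lt_min dl10 dla0.
- by move=> i j z w ij jN gz gw; rewrite ge_min far1 //; lia.
- by move=> i z iN gz i0; rewrite !ge_min fara ?orbT.
- by move=> i z iN gz i0; rewrite !ge_min farb ?orbT.
Qed.

(** * Parametrization of the arc *)

Section ArcParametrization.
Context {R : realType} {n N : nat} {S : nat -> 'rV[R]_n -> 'rV[R]_n}
  {gamma : set 'rV[R]_n} {a b : 'rV[R]_n} {c : nat -> R} {cmin cmax D delta : R}.
Hypothesis H : @arc_data R n N S gamma a b c cmin cmax D delta.
Local Notation d := (@eucl_dist R n).
Local Notation q := (N%:R^-1 : R).

Lemma c_gt0 i : (i < N)%N -> 0 < c i.
Proof. by move=> /(c_bounds H)/andP[+ _]; apply: lt_le_trans (cmin_gt0 H). Qed.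

Lemma cmax_gt0 : 0 < cmax.
Proof.
have N0 : (0 < N)%N by have := arc_N H; lia.
by have /andP[_] := c_bounds H 0%N N0; apply: lt_le_trans (c_gt0 _ N0).
Qed.

Lemma S_inj i : (i < N)%N -> injective (S i).
Proof.
by move=> iN; apply: similarity_injective (c_gt0 i iN) _ => x y; exact: distS H _ _ _ iN.
Qed.

Lemma S_continuous i : (i < N)%N -> continuous (S i).
Proof.
by move=> iN; apply: similarity_continuous (c_gt0 i iN) _ => x y; exact: distS H _ _ _ iN.
Qed.

Lemma piece_compact i : (i < N)%N -> compact (S i @` gamma).
Proof.
move=> iN; apply: continuous_compact (arc_compact H); apply: continuous_subspaceT.
exact: S_continuous.
Qed.

Lemma meet_a i z : (i < N)%N -> gamma z -> a = S i z -> i = 0%N /\ z = a.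
Proof.
have N0 : (0 < N)%N by have := arc_N H; lia.
case: i => [|i] iN gz az; first by split => //; apply: (S_inj 0%N N0); rewrite (Sa H).
have [|_ /(arc_neq H)//] := pieces_meet H 0%N i.+1 a z (ltn0Sn _) iN (arc_a H) gz.
by rewrite (Sa H).
Qed.

Lemma meet_b i z : (i < N)%N -> gamma z -> b = S i z -> i = N.-1 /\ z = b.
Proof.
have N1 : (N.-1 < N)%N by have := arc_N H; lia.
move=> iN gz bz; have [ij|ij] := eqVneq i N.-1.
  by split => //; apply: (S_inj i iN); rewrite -bz ij (Sb H).
have [||_ _ /esym/(arc_neq H)//] :=
    pieces_meet H i N.-1 z b _ N1 gz (arc_b H); first by move/eqP: ij; lia.
by rewrite (Sb H).
Qed.

Lemma q_gt0 : 0 < q.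
Proof. by rewrite invr_gt0 ltr0n; have := arc_N H; lia. Qed.

Lemma Nq : N%:R * q = 1.
Proof. by rewrite mulfV // pnatr_eq0; have := arc_N H; lia. Qed.

Lemma q_lt1 : q < 1.
Proof. by rewrite invf_lt1 ?ltr0n ?ltr1n; have := arc_N H; lia. Qed.

(* [h x] is the number whose base [N] digits are an address of [x]. *)
Lemma address_function : exists h : 'rV[R]_n -> R,
  (forall x, gamma x -> 0 <= h x <= 1) /\
  (forall i z, (i < N)%N -> gamma z -> h (S i z) = (i%:R + h z) * q).
Proof.
have q0 := q_gt0; have q1 := q_lt1; have Nq1 := Nq.
(* A chosen first digit and the remaining point; the choice is ambiguous only at junctions. *)
have /choice[f fP] : forall x, exists p : nat * 'rV[R]_n,
    gamma x -> [/\ (p.1 < N)%N, gamma p.2 & x = S p.1 p.2].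
  move=> x; have [gx|] := pselect (gamma x); last by exists (0%N, 0).
  by have [i [z zP]] := arcE H x gx; exists (i, z).
(* [hm m x] is the number formed by the first [m] digits of the chosen address; [h] will be its
   limit. *)
pose fix hm (m : nat) (x : 'rV[R]_n) {struct m} : R :=
  if m is k.+1 then ((f x).1%:R + hm k (f x).2) * q else 0.
have hm0 x : hm 0%N x = 0 by [].
have hmS m x : hm m.+1 x = ((f x).1%:R + hm m (f x).2) * q by [].
clearbody hm.
have hm_ge0 m x : gamma x -> 0 <= hm m x.
  elim: m x => [|m IH] x; first by rewrite hm0.
  by move=> /fP[_ g2 _]; rewrite hmS mulr_ge0 ?addr_ge0 ?IH ?(ltW q0).
have hm_le1 m x : gamma x -> hm m x <= 1.
  elim: m x => [|m IH] x; first by rewrite hm0.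
  move=> /fP[iN g2 _]; rewrite hmS -[leRHS]Nq1 ler_pM2r //.
  have : (f x).1.+1%:R <= N%:R :> R by rewrite ler_nat.
  by rewrite -natr1; have := IH _ g2; lra.
have hm_mono x : gamma x -> nondecreasing_seq (hm ^~ x).
  move=> gx; apply/nondecreasing_seqP => m; elim: m x gx => [|m IH] x gx.
    by rewrite hm0; exact: hm_ge0.
  have [_ g2 _] := fP x gx.
  by rewrite hmS [leRHS]hmS ler_pM2r // lerD2l IH.
have hm_cvg x : gamma x -> cvgn (hm ^~ x).
  move=> gx; apply: nondecreasing_is_cvgn; first exact: hm_mono.
  by exists 1 => _ [m _ <-]; exact: hm_le1.
pose h x := limn (hm ^~ x).
have h01 x : gamma x -> 0 <= h x <= 1.
  move=> gx; apply/andP; split.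
    by apply: limr_ge; [exact: hm_cvg|near=> m; exact: hm_ge0].
  by apply: limr_le; [exact: hm_cvg|near=> m; exact: hm_le1].
have hE x : gamma x -> h x = ((f x).1%:R + h (f x).2) * q.
  move=> gx; have [_ g2 _] := fP x gx.
  have := hm_cvg x gx; rewrite -(cvg_shiftS (hm ^~ x)) /=.
  under eq_fun do rewrite hmS.
  move=> c1.
  have c2 : (fun m => ((f x).1%:R + hm m (f x).2) * q) @ \oo -->
      ((f x).1%:R + h (f x).2) * q.
    by apply: cvgMl; apply: cvgD; [exact: cvg_cst|exact: hm_cvg].
  exact: cvg_unique c1 c2.
(* [a] has first digit 0 and is its own remainder, so [h a = h a * q] forces 0. Likewise [h b] is
   the fixed point 1 of [t -> (N - 1 + t) * q]. *)
have ha : h a = 0.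
  have [iN gz az] := fP a (arc_a H); have := hE a (arc_a H).
  have [-> ->] := meet_a _ _ iN gz az; rewrite add0r => e.
  have : h a * (1 - q) = 0 by lra.
  by move=> /eqP; rewrite mulf_eq0 => /orP[/eqP//|/eqP]; lra.
have hb : h b = 1.
  have [iN gz bz] := fP b (arc_b H); have := hE b (arc_b H).
  have [-> ->] := meet_b _ _ iN gz bz => e.
  have NE : N.-1%:R = N%:R - 1 :> R.
    by rewrite -subn1 natrB //; have := arc_N H; lia.
  have : (h b - 1) * (1 - q) = 0 by move: e; rewrite NE; lra.
  by move=> /eqP; rewrite mulf_eq0 => /orP[/eqP|/eqP]; lra.
exists h; split => // i z iN gz.
have gx : gamma (S i z) by exact: arcS H _ _ iN gz.
rewrite (hE _ gx); have [jN gw xw] := fP _ gx.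
move: (f (S i z)).1 (f (S i z)).2 jN gw xw => j w jN gw zw.
(* Different first digits occur only at a junction, where the remainders are [b] and [a]; the values
   agree there because [h b = 1] acts as a carry. *)
have [ij|ji|ij] := ltngtP i j.
- have [-> -> ->] := pieces_meet H i j z w ij jN gz gw zw.
  by rewrite ha hb -natr1; lra.
- have [-> -> ->] := pieces_meet H j i w z ji iN gw gz (esym zw).
  by rewrite ha hb -natr1; lra.
- by move: zw; rewrite -ij => /(S_inj i iN) ->.
Unshelve. all: by end_near.
Qed.

(** Outside a ball about the junction, piece [i] is compact and disjoint from piece [i.+1], hence at
    a positive distance from it. The radius [e / 2] leaves room to reach the second point by the
    triangle inequality. *)
Lemma junction_close e : 0 < e -> exists2 k, 0 < k &
  forall i, (i.+1 < N)%N -> forall z w, gamma z -> gamma w ->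
  d (S i z) (S i.+1 w) < k -> d (S i z) (S i b) < e /\ d (S i.+1 w) (S i b) < e.
Proof.
move=> e0; have e2 : 0 < e / 2 by rewrite divr_gt0.
have [k k0 kP] : exists2 k, 0 < k & forall i, (i < N)%N -> forall z w,
    (i.+1 < N)%N -> gamma z -> gamma w -> d (S i z) (S i.+1 w) < k ->
    d (S i z) (S i b) < e / 2.
  apply: finite_uniform => [i k k' kP _ kk z w iN gz gw zw|i iN].
    exact: kP iN gz gw (lt_le_trans zw kk).
  have [iN'|] := boolP (i.+1 < N)%N; last by exists 1.
  have cB : compact (S i @` gamma `&` ~` eball (S i b) (e / 2)).
    apply: compact_closedI (piece_compact i iN) _.
    exact: open_closedC (eball_open _ _).
  have [|k k0 kP] := compact_disjoint_dist _ _ cB (piece_compact i.+1 iN').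
    apply/seteqP; split => // x [[[z gz <-] xe] [w gw zw]] /=; apply: xe.
    have [_ -> _] := pieces_meet H i i.+1 z w (ltnSn _) iN' gz gw (esym zw).
    by rewrite /eball /= eucl_distxx.
  exists k => // z w _ gz gw zw; rewrite ltNge; apply/negP => ze.
  suff : k <= d (S i z) (S i.+1 w) by rewrite leNgt zw.
  apply: kP; last by exists w.
  split; first by exists z.
  by rewrite /eball /= eucl_distC => /lt_geF; rewrite ze.
exists (Num.min k (e / 2)); first by rewrite lt_min k0.
move=> i iN z w gz gw; rewrite lt_min => /andP[zk ze].
have h1 := kP i (ltnW iN) z w iN gz gw zk.
have := eucl_dist_triangle (S i z) (S i.+1 w) (S i b).
rewrite [d (S i.+1 w) (S i z)]eucl_distC; split; lra.
Qed.

(** * Moduli of continuity of the address and of its inverse *)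

Section Address.
Variable h : 'rV[R]_n -> R.
Hypothesis h01 : forall x, gamma x -> 0 <= h x <= 1.
Hypothesis hS : forall i z, (i < N)%N -> gamma z -> h (S i z) = (i%:R + h z) * q.

(** Treats both endpoints at once: the instances are [(0, a, 0)] and [(N.-1, b, 1)], with [e] the
    address of [p]. *)
Record arc_end (k : nat) (p : 'rV[R]_n) (e : R) : Prop := ArcEnd {
  end_N : (k < N)%N;
  end_fix : S k p = p;
  end_mem : gamma p;
  end_val : 0 <= e <= 1;
  end_eq : (k%:R + e) * q = e;
  end_uniq : forall j w, (j < N)%N -> gamma w -> `|h (S j w) - e| < q -> j = k;
  end_far : forall j w, (j < N)%N -> gamma w -> j <> k -> delta <= d (S j w) p }.

Lemma arc_end_a : arc_end 0%N a 0.
Proof.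
have q0 := q_gt0; split => //.
- by have := arc_N H; lia.
- exact: Sa H.
- exact: arc_a H.
- by rewrite lexx ler01.
- by rewrite addr0 mul0r.
- move=> [//|j] w jN gw; have /andP[w0 _] := h01 w gw.
  rewrite subr0 hS // ger0_norm ?mulr_ge0 ?addr_ge0 ?(ltW q0) //.
  by rewrite gtr_pMl // -natr1 => ?; exfalso; have := ler0n R j; lra.
- exact: a_far H.
Qed.

Lemma arc_end_b : arc_end N.-1 b 1.
Proof.
have q0 := q_gt0; have Nq1 := Nq; have N0 : (0 < N)%N by have := arc_N H; lia.
split => //.
- by rewrite ltn_predL.
- exact: Sb H.
- exact: arc_b H.
- by rewrite lexx ler01.
- by rewrite natr1 prednK.
- move=> j w jN gw; have /andP[_ w1] := h01 w gw.
  rewrite hS // distrC -{1}Nq1 -mulrBl.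
  move=> /(le_lt_trans (ler_norm _)); rewrite gtr_pMl // => jw.
  apply/eqP; rewrite -eqSS prednK // eqn_leq jN leqNgt; apply/negP => jN'.
  have : j.+2%:R <= N%:R :> R by rewrite ler_nat.
  by rewrite -!natr1; lra.
- exact: b_far H.
Qed.

Lemma end_S k p e w : arc_end k p e -> gamma w -> h (S k w) - e = (h w - e) * q.
Proof. by move=> E gw; rewrite hS ?(end_N _ _ _ E)// -{1}(end_eq _ _ _ E); ring. Qed.

(** Addresses within [q] of [e] begin with the digit [k], so [S k] can be undone; this multiplies
    the address gap by [q^-1] and the distance to [p] by at least [cmax^-1]. *)
Lemma end_inv k p e : arc_end k p e -> forall m z, gamma z ->
  `|h z - e| < q ^+ m -> d z p <= D * cmax ^+ m.
Proof.
move=> E; have q0 := q_gt0; elim=> [|m IH] z gz.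
  by move=> _; rewrite expr0 mulr1; apply/ltW/(arc_diam H) => //; exact: end_mem _ _ _ E.
have [j [w [jN gw ->]]] := arcE H z gz => hz.
have jk : j = k.
  apply: (end_uniq _ _ _ E j w) => //; apply: lt_le_trans hz _.
  rewrite exprS ger_pMr // exprn_ile1 ?ltW //; exact: q_lt1.
subst j; move: hz; rewrite (end_S _ _ _ _ E) // normrM [`|q|]gtr0_norm //.
rewrite exprSr ltr_pM2r // => /(IH w gw) hw.
rewrite -{1}(end_fix _ _ _ E) (distS H) // exprS mulrCA.
apply: ler_pM => //; [by rewrite ltW // c_gt0|exact: eucl_dist_ge0|].
by have /andP[] := c_bounds H k jN.
Qed.

(** Points within [delta] of [p] lie in piece [k]; undoing [S k] multiplies the distance by at most
    [cmin^-1] and the address gap by [q^-1]. *)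
Lemma end_cont k p e : arc_end k p e -> forall m, exists2 r, 0 < r &
  forall z, gamma z -> d z p < r -> `|h z - e| <= q ^+ m.
Proof.
move=> E; have q0 := q_gt0; elim=> [|m [r r0 IH]].
  exists 1 => // z gz _; rewrite expr0 ler_norml.
  by have := h01 z gz; have := end_val _ _ _ E; lra.
have cm0 := cmin_gt0 H.
exists (Num.min delta (cmin * r)); first by rewrite lt_min (delta_gt0 H) mulr_gt0.
move=> z gz; have [j [w [jN gw ->]]] := arcE H z gz.
rewrite lt_min => /andP[zd zr].
have jk : j = k.
  apply: contrapT => /(end_far _ _ _ E _ _ jN gw); lra.
subst j; rewrite (end_S _ _ _ _ E) // normrM [`|q|]gtr0_norm // exprSr ler_pM2r //.
apply: IH => //; rewrite -(ltr_pM2l cm0); apply: le_lt_trans zr.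
rewrite -{2}(end_fix _ _ _ E) (distS H) // ler_wpM2r ?eucl_dist_ge0 //.
by have /andP[] := c_bounds H k jN.
Qed.

(** Common first digits are stripped off. When the digits differ they are consecutive, both points
    are close in address to the junction, and [end_inv] applies on each side; the two legs give the
    factor 2. *)
Lemma address_inv m : forall x y, gamma x -> gamma y -> `|h x - h y| < q ^+ m ->
  d x y <= 2 * D * cmax ^+ m.
Proof.
have q0 := q_gt0; have D0 := D_gt0 H; have cM0 := cmax_gt0.
elim: m => [|m IH] x y gx gy.
  by move=> _; rewrite expr0 mulr1; have := arc_diam H x y gx gy; lra.
have [i [z [iN gz ->]]] := arcE H x gx; have [j [w [jN gw ->]]] := arcE H y gy.
wlog ij : i j z w iN jN gz gw / (i <= j)%N.
  have [ij|/ltnW ji] := leqP i j; first exact.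
  by rewrite distrC [d _ _]eucl_distC; apply.
rewrite !hS // -mulrBl normrM [`|q|]gtr0_norm // exprSr ltr_pM2r //.
have /andP[z0 z1] := h01 z gz; have /andP[w0 w1] := h01 w gw.
have qm1 : q ^+ m <= 1 by rewrite exprn_ile1 ?ltW //; exact: q_lt1.
have cP k : (k < N)%N -> 0 <= c k <= cmax.
  by move=> kN; rewrite ltW ?c_gt0 //=; have /andP[] := c_bounds H k kN.
have scale k u v M : (k < N)%N -> d u v <= M -> d (S k u) (S k v) <= cmax * M.
  move=> kN uv; rewrite (distS H) //; have /andP[? ?] := cP k kN.
  by apply: ler_pM => //; exact: eucl_dist_ge0.
rewrite exprS; have [ij'|ij'|<-] := ltngtP i j; last first.
- rewrite opprD addrACA subrr add0r => /(IH z w gz gw) h1.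
  by rewrite mulrCA; exact: scale.
- by lia.
rewrite distrC => /(le_lt_trans (ler_norm _)) zw.
have ji : j = i.+1.
  apply/eqP; rewrite eqn_leq ij' andbT leqNgt; apply/negP => ij2.
  have : i.+2%:R <= j%:R :> R by rewrite ler_nat.
  by rewrite -!natr1; lra.
subst j; move: zw; rewrite -natr1 => zw.
have zb : d z b <= D * cmax ^+ m.
  by apply: (end_inv _ _ _ arc_end_b) => //; rewrite distrC ger0_norm; lra.
have wa : d a w <= D * cmax ^+ m.
  by rewrite eucl_distC; apply: (end_inv _ _ _ arc_end_a) => //; rewrite subr0 ger0_norm; lra.
apply: le_trans (eucl_dist_triangle (S i b) _ _) _.
rewrite {2}(Sab H) //; have := scale i z b _ iN zb; have := scale i.+1 a w _ jN wa.
lra.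
Qed.

(** Points closer than [delta] lie in equal or adjacent pieces. In one piece the induction
    hypothesis is rescaled; across a junction [junction_close] and [end_cont] bound the gap on each
    side, whence the factor 2. *)
Lemma address_cont m : exists2 r, 0 < r &
  forall x y, gamma x -> gamma y -> d x y < r -> `|h x - h y| <= 2 * q ^+ m.
Proof.
have q0 := q_gt0; have cm0 := cmin_gt0 H; have d0 := delta_gt0 H.
elim: m => [|m [r r0 IH]].
  exists 1 => // x y gx gy _; rewrite expr0 mulr1 ler_norml.
  by have := h01 x gx; have := h01 y gy; lra.
have [ra ra0 raP] := end_cont _ _ _ arc_end_a m.
have [rb rb0 rbP] := end_cont _ _ _ arc_end_b m.
have [|k k0 kP] := junction_close (cmin * Num.min ra rb).
  by rewrite mulr_gt0 // lt_min ra0.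
exists (Num.min delta (Num.min k (cmin * r))).
  by rewrite !lt_min d0 k0 mulr_gt0.
move=> x y gx gy.
have [i [z [iN gz ->]]] := arcE H x gx; have [j [w [jN gw ->]]] := arcE H y gy.
wlog ij : i j z w iN jN gz gw / (i <= j)%N.
  have [ij|/ltnW ji] := leqP i j; first exact.
  by rewrite distrC [d _ _]eucl_distC; apply.
have unscale l u v M : (l < N)%N -> d (S l u) (S l v) < cmin * M -> d u v < M.
  move=> lN uv; rewrite -(ltr_pM2l cm0); apply: le_lt_trans uv.
  by rewrite (distS H) // ler_wpM2r ?eucl_dist_ge0 //; have /andP[] := c_bounds H l lN.
rewrite !lt_min => /and3P[zd zk zr].
rewrite !hS // -mulrBl normrM [`|q|]gtr0_norm // exprSr mulrA ler_pM2r //.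
have [ij'|ij'|ij'] := ltngtP i j; last first.
- by subst j; rewrite opprD addrACA subrr add0r; apply: IH => //; exact: unscale iN zr.
- by lia.
have ji : j = i.+1.
  apply: contrapT => ji; have : delta <= d (S i z) (S j w).
    by apply: (pieces_far H) => //; lia.
  by rewrite leNgt zd.
subst j; have [zb wa] := kP i jN z w gz gw zk.
have {}zb : `|h z - 1| <= q ^+ m.
  apply: rbP => //; apply: lt_le_trans (unscale _ _ _ _ iN zb) _.
  by rewrite ge_min lexx orbT.
have {}wa : `|h w - 0| <= q ^+ m.
  apply: raP => //; rewrite (Sab H) // in wa.
  by apply: lt_le_trans (unscale _ _ _ _ jN wa) _; rewrite ge_min lexx.
move: zb wa; rewrite -natr1 !ler_norml; lra.
Qed.

End Address.

(** A homeomorphism of [gamma] onto its image in the line, uniform both ways. It orders the arc, so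
    that passing through a junction becomes an intermediate value statement. *)
Lemma arc_parametrization : exists h : 'rV[R]_n -> R,
  eucl_unif_continuous_on gamma h /\
  (forall e, 0 < e -> exists2 k, 0 < k &
     forall x y, gamma x -> gamma y -> `|h x - h y| < k -> d x y < e).
Proof.
have [h [h01 hS]] := address_function; have q0 := q_gt0.
exists h; split => e e0.
  have [m me] := exprn_cvg_small q 2 e q0 q_lt1 e0.
  have [r r0 rP] := address_cont h h01 hS m.
  by exists r => // x y gx gy /(rP x y gx gy)/le_lt_trans; exact.
have [m me] := exprn_cvg_small cmax (2 * D) e cmax_gt0 (cmax_lt1 H) e0.
exists (q ^+ m); first exact: exprn_gt0.
by move=> x y gx gy /(address_inv h h01 hS m x y gx gy)/le_lt_trans; exact.
Qed.

End ArcParametrization.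

(** * Neighbourhoods of the endpoints *)

Section EndpointNeighbourhoods.
Context {R : realType} {n N : nat} {S : nat -> 'rV[R]_n -> 'rV[R]_n}
  {gamma : set 'rV[R]_n} {a b : 'rV[R]_n} {c : nat -> R} {cmin cmax D delta : R}.
Hypothesis H : @arc_data R n N S gamma a b c cmin cmax D delta.
Local Notation d := (@eucl_dist R n).

(** Undoing [S i] turns scale [t] into [t / c i]; the inequality is what [scale_ind] with ratio
    [cmax] asks for. *)
Lemma scale_step i t : (i < N)%N -> 0 < t -> 0 < t / c i /\ t <= cmax * (t / c i).
Proof.
move=> iN t0; have ci := c_gt0 H i iN; have tc : 0 < t / c i by exact: divr_gt0.
have tE : t = c i * (t / c i) by rewrite mulrC mulfVK // lt0r_neq0.
split => //; rewrite {1}tE ler_pM2r //.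
by have /andP[] := c_bounds H i iN.
Qed.

Lemma S_inverse i : (i < N)%N -> exists f, cancel (S i) f.
Proof.
move=> iN; have /choice[f fP] : forall y, exists z, forall w, S i w = y -> w = z.
  move=> y; have [[z zy]|nz] := pselect (exists z, S i z = y).
    by exists z => w wy; apply: (S_inj H i iN); rewrite wy.
  by exists y => w wy; case: nz; exists w.
by exists f => w; exact/esym/fP.
Qed.

(** * Connectedness of the arc *)

(** Induction on scale: [X] composed with [S i] is locally constant at the larger scale [e / c i],
    so [X] is constant on each piece, and the junctions link the pieces. Above the diameter bound
    [D] all points are close. *)
Lemma locally_constant e (X : 'rV[R]_n -> Prop) : 0 < e ->
  (forall x y, gamma x -> gamma y -> d x y < e -> X x -> X y) ->
  forall x y, gamma x -> gamma y -> X x -> X y.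
Proof.
move=> e0; move: e e0 X; apply: (scale_ind cmax D).
- exact: cmax_gt0 H.
- exact: cmax_lt1 H.
- exact: D_gt0 H.
move=> e e0 IH X Xe.
have [eD|De] := ltP e D; last first.
  move=> x y gx gy; apply: Xe => //.
  by apply: lt_le_trans De; exact: arc_diam H _ _ gx gy.
have Xi i z w : (i < N)%N -> gamma z -> gamma w -> X (S i z) -> X (S i w).
  move=> iN; have [s0 es] := scale_step i e iN e0.
  move: z w; apply: (IH eD _ es (X \o S i)) => z w gz gw zw.
  apply: Xe; [exact: arcS H _ _ iN gz|exact: arcS H _ _ iN gw|].
  by rewrite (distS H) // mulrC -ltr_pdivlMr // (c_gt0 H).
have ga := arc_a H; have gb := arc_b H.
have X0 i : (i < N)%N -> X (S i a) <-> X (S 0%N a).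
  elim: i => // i IHi iN; rewrite -IHi; last by lia.
  by rewrite -(Sab H) //; split; apply: Xi => //; lia.
move=> x y gx gy; have [i [z [iN gz ->]]] := arcE H x gx.
have [j [w [jN gw ->]]] := arcE H y gy.
by move=> /(Xi i z a iN gz ga)/(X0 i iN)/(X0 j jN)/(Xi j a w jN ga gw).
Qed.

(** A relatively clopen [B] and its complement in [gamma] are disjoint compact sets, so membership
    in [B] is locally constant at the scale of their distance. *)
Lemma arc_connected : connected gamma.
Proof.
move=> B [x Bx] [C oC BC] [F cF BF].
have cB : compact B by rewrite BF; exact: compact_closedI (arc_compact H) cF.
have cC : compact (gamma `&` ~` C).
  exact: compact_closedI (arc_compact H) (open_closedC oC).
have [|e e0 eP] := compact_disjoint_dist _ _ cB cC.
  by apply/seteqP; split => // y; rewrite BC => -[[_ Cy] [_]].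
apply/seteqP; split => [y|y gy]; first by rewrite BC => -[].
have gx : gamma x by move: Bx; rewrite BC => -[].
apply: (locally_constant e B e0 _ x y gx gy Bx) => u v gu gv uv Bu.
rewrite BC; split => //; apply: contrapT => Cv.
by have := eP u v Bu (conj gv Cv); rewrite leNgt uv.
Qed.

Lemma continuum_image i E : (i < N)%N -> continuum E -> continuum (S i @` E).
Proof.
move=> iN [cE [nE [x Ex]]]; have cS := continuous_subspaceT (S_continuous H i iN).
split; first exact: continuous_compact (cS _) cE.
split; first exact: connected_continuous_connected nE (cS _).
by exists (S i x), x.
Qed.

Lemma arc_continuum : continuum gamma.
Proof.
split; first exact: arc_compact H; split; first exact: arc_connected.
by exists a; exact: arc_a H.
Qed.

(** * Zooming at a fixed endpoint *)

Section Endpoint.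
Variables (k : nat) (p : 'rV[R]_n).
Hypotheses (kN : (k < N)%N) (fixp : S k p = p) (gp : gamma p).
Hypothesis farp : forall i z, (i < N)%N -> gamma z -> i <> k ->
  delta <= d (S i z) p.

Lemma near_endpoint y : gamma y -> d y p < delta -> exists2 z, gamma z & y = S k z.
Proof.
move=> gy; have [i [z [iN gz ->]]] := arcE H y gy => zp.
exists z => //; congr S; apply: contrapT => /(farp i z iN gz).
by rewrite leNgt zp.
Qed.

Lemma dist_endpoint z : d (S k z) p = c k * d z p.
Proof. by rewrite -{1}fixp (distS H). Qed.

(** For [y <> p] the continuum is a copy of [gamma] under an iterate of [S k]: this map is undone
    until the distance to [p] is at least [delta], where [gamma] itself works. Both sides of the
    bound scale alike. *)
Lemma endpoint_continuum y : gamma y -> exists E, [/\ E `<=` gamma, continuum E,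
  E y, E p & forall e, E e -> d e p <= (D / delta) * d y p].
Proof.
move=> gy; have dl0 := delta_gt0 H; have D0 := D_gt0 H.
have [yp|yp] := pselect (y = p).
  exists [set p]; split => //.
  - by move=> _ ->.
  - split; first exact: compact_set1; split; [exact: connected1|by exists p].
  - by move=> _ ->; rewrite yp eucl_distxx mulr0.
have t0 : 0 < d y p.
  rewrite lt_neqAle eucl_dist_ge0 andbT; apply/negP => /eqP/esym.
  by move=> /eucl_dist_eq0.
suff : forall t, 0 < t -> forall y, gamma y -> d y p = t -> exists E,
    [/\ E `<=` gamma, continuum E, E y, E p &
        forall e, E e -> d e p <= (D / delta) * d y p].
  by move=> /(_ _ t0 y gy erefl).
clear y gy yp t0; apply: (scale_ind cmax delta) => //.
- exact: cmax_gt0 H.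
- exact: cmax_lt1 H.
move=> t t0 IH y gy yt; have [td|dt] := ltP t delta; last first.
  exists gamma; split => //; first exact: arc_continuum.
  move=> e ge; apply: le_trans (ltW (arc_diam H _ _ ge gp)) _.
  by rewrite yt mulrAC ler_pdivlMr // ler_pM2l.
have [z gz yz] := near_endpoint y gy (eq_ind_r (fun u => u < delta) td yt).
have [s0 ts] := scale_step k t kN t0; have ck := c_gt0 H k kN.
have [|E [Eg cE Ez Ep Ed]] := IH td _ ts z gz.
  by rewrite -yt yz dist_endpoint mulrAC mulfV ?mul1r // lt0r_neq0.
exists (S k @` E); split.
- by move=> _ [e /Eg ge <-]; exact: arcS H _ _ kN ge.
- exact: continuum_image.
- by exists z.
- by exists p.
- move=> _ [e Ee <-]; rewrite yz !dist_endpoint mulrCA ler_pM2l //; exact: Ed.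
Qed.

(* Blow up by powers of the similarity [S k] fixing the endpoint [p]. *)
Lemma endpoint_zoom t : 0 < t -> t <= delta / c k ->
  exists g : 'rV[R]_n -> 'rV[R]_n, exists rho,
  [/\ forall y, gamma y -> d y p <= t -> gamma (g y),
      forall y z, gamma y -> gamma z -> d y p <= t -> d z p <= t ->
        d (g y) (g z) = rho * d y z,
      g p = p & delta <= rho * t <= delta / c k].
Proof.
have dl0 := delta_gt0 H; have ck := c_gt0 H k kN.
move: t; apply: (scale_ind cmax delta) => //.
- exact: cmax_gt0 H.
- exact: cmax_lt1 H.
move=> t t0 IH tk; have [td|dt] := ltP t delta; last first.
  exists id, 1; split => //; last by rewrite mul1r dt.
  by move=> *; rewrite mul1r.
have [s0 ts] := scale_step k t kN t0.
have [|g [rho [gg gd gfix rhoP]]] := IH td _ ts.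
  by rewrite ler_pM2r ?invr_gt0 // ltW.
have [f fK] := S_inverse k kN.
have near y : gamma y -> d y p <= t -> [/\ gamma (f y), d (f y) p <= t / c k &
    y = S k (f y)].
  move=> gy yt; have [z gz yz] := near_endpoint y gy (le_lt_trans yt td).
  move: yt; rewrite yz fK dist_endpoint; split => //.
  by rewrite ler_pdivlMr // mulrC.
exists (g \o f), (rho / c k); split.
- by move=> y gy yt; have [gf ft _] := near y gy yt; exact: gg.
- move=> y z gy gz yt zt; have [gf ft yE] := near y gy yt.
  have [gf' ft' zE] := near z gz zt.
  by rewrite /= gd // {2}yE {2}zE (distS H) // mulrA mulfVK // lt0r_neq0.
- by rewrite /= -{1}fixp fK.
- by rewrite mulrAC -mulrA.
Qed.

(** The map is [S j] after the zoom at [p] after the inverse of [S i]. It carries a small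
    neighbourhood of [S i p] in piece [i] into piece [j], at a scale [sigma * t] comparable to
    [delta] whatever [t] is. *)
Lemma endpoint_rescale i j t : (i < N)%N -> (j < N)%N -> 0 < t ->
  t <= cmin * delta ->
  exists f : 'rV[R]_n -> 'rV[R]_n, exists sigma,
  [/\ forall z, gamma z -> d (S i z) (S i p) <= t ->
        exists2 w, gamma w & f (S i z) = S j w,
      forall z w, gamma z -> gamma w ->
        d (S i z) (S i p) <= t -> d (S i w) (S i p) <= t ->
        d (f (S i z)) (f (S i w)) = sigma * d (S i z) (S i w),
      f (S i p) = S j p, cmin * delta <= sigma * t & cmin * sigma * t <= delta].
Proof.
move=> iN jN t0 tm; have ci := c_gt0 H i iN; have cj := c_gt0 H j jN.
have ck := c_gt0 H k kN; have dl0 := delta_gt0 H; have cm0 := cmin_gt0 H.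
have /andP[mi _] := c_bounds H i iN.
have /andP[mj Mj] := c_bounds H j jN; have /andP[mk Mk] := c_bounds H k kN.
have cM := cmax_lt1 H.
have [||g [rho [gg gd gfix /andP[r1 r2]]]] := endpoint_zoom (t / c i).
- exact: divr_gt0.
- rewrite ler_pdivrMr // mulrAC ler_pdivlMr //.
  have : t * c k <= t by rewrite ler_piMr ?ltW //; lra.
  have : cmin * delta <= delta * c i by rewrite mulrC ler_pM2l.
  lra.
have [f fK] := S_inverse i iN.
have near z : d (S i z) (S i p) <= t -> d z p <= t / c i.
  by rewrite (distS H) // ler_pdivlMr // mulrC.
have E : c j * rho / c i * t = c j * (rho * (t / c i)) by ring.
exists (S j \o g \o f), (c j * rho / c i); split.
- by move=> z gz zt; exists (g z); [exact: gg _ gz (near z zt)|rewrite /= fK].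
- move=> z w gz gw zt wt; rewrite /= !fK (distS H) // gd //; try exact: near.
  by rewrite (distS H _ _ _ iN); field; rewrite lt0r_neq0.
- by rewrite /= fK gfix.
- by rewrite E; apply: ler_pM => //; exact: ltW.
- rewrite -mulrA E; move: r2; rewrite ler_pdivlMr // => r2.
  have r0 : 0 <= rho * (t / c i) by lra.
  apply: le_trans r2; rewrite mulrA mulrC; apply: ler_wpM2l => //.
  apply: le_trans (mk); rewrite ler_piMr ?ltW //; lra.
Qed.

End Endpoint.
End EndpointNeighbourhoods.

(** * Junction separation *)

Section BoundedTurning.
Context {R : realType} {n N : nat} {S : nat -> 'rV[R]_n -> 'rV[R]_n}
  {gamma : set 'rV[R]_n} {a b : 'rV[R]_n} {c : nat -> R} {cmin cmax D delta : R}.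
Hypothesis H : @arc_data R n N S gamma a b c cmin cmax D delta.
Local Notation d := (@eucl_dist R n).

(** The triangle inequality through the junction, reversed up to the factor [kappa]. *)
Definition junction_separated (kappa : R) :=
  forall i, (i.+1 < N)%N -> forall z w, gamma z -> gamma w ->
  kappa * (d (S i z) (S i b) + d (S i.+1 w) (S i b)) <= d (S i z) (S i.+1 w).

Let dge0 := @eucl_dist_ge0 R n.

Let kN0 : (0 < N)%N. Proof. by have := arc_N H; lia. Qed.
Let kN1 : (N.-1 < N)%N. Proof. by have := arc_N H; lia. Qed.

Definition continuum_at_a := endpoint_continuum H 0%N a kN0 (Sa H) (arc_a H) (a_far H).
Definition continuum_at_b := endpoint_continuum H N.-1 b kN1 (Sb H) (arc_b H) (b_far H).
Definition rescale_at_a := endpoint_rescale H 0%N a kN0 (Sa H) (a_far H).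
Definition rescale_at_b := endpoint_rescale H N.-1 b kN1 (Sb H) (b_far H).

Lemma piece_sub i : (i < N)%N -> S i @` gamma `<=` gamma.
Proof. by move=> iN _ [z gz <-]; exact: arcS H _ _ iN gz. Qed.

Lemma piece_continuum i : (i < N)%N -> continuum (S i @` gamma).
Proof. by move=> iN; apply: continuum_image H _ _ iN (arc_continuum H). Qed.

Lemma adjacent_meet i y : (i.+1 < N)%N -> (S i @` gamma) y ->
  (S i.+1 @` gamma) y -> y = S i b.
Proof.
move=> iN [z gz <-] [w gw wz].
by have [_ -> _] := pieces_meet H i i.+1 z w (ltnSn _) iN gz gw (esym wz).
Qed.

Lemma same_or_adjacent i j z w : (i < N)%N -> (j < N)%N -> gamma z -> gamma w ->
  d (S i z) (S j w) < delta -> [\/ i = j, j = i.+1 | i = j.+1].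
Proof.
move=> iN jN gz gw zw; have [ij|ij|ij] := ltngtP i j; last by constructor 1.
- constructor 2; apply: contrapT => ji.
  have := pieces_far H i j z w; rewrite leNgt zw => far.
  by suff : false by []; apply: far => //; lia.
- constructor 3; apply: contrapT => ji.
  have := pieces_far H j i w z; rewrite eucl_distC leNgt zw => far.
  by suff : false by []; apply: far => //; lia.
Qed.

Lemma parametrization_inj (h : 'rV[R]_n -> R) :
  (forall e, 0 < e -> exists2 k, 0 < k &
     forall x y, gamma x -> gamma y -> `|h x - h y| < k -> d x y < e) ->
  forall y z, gamma y -> gamma z -> h y = h z -> y = z.
Proof.
move=> hi y z gy gz hyz; apply: eucl_dist_eq0; apply/eqP.
rewrite eq_le dge0 andbT leNgt; apply/negP => d0; have [k k0 kP] := hi _ d0.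
by have := kP y z gy gz; rewrite hyz subrr normr0 ltxx => /(_ k0).
Qed.

(* The images under [h \o phi] of two connected sets meeting at [x] are
   intervals on both sides of [h (phi x)]; as [h] is a homeomorphism onto its
   image, [phi x] is close to any two close points taken from either side. *)
Lemma cross_junction_bound e : 0 < e -> exists2 k, 0 < k &
  forall E1 E2 (phi : 'rV[R]_n -> 'rV[R]_n) L x u v,
  connected E1 -> connected E2 -> E1 x -> E2 x -> E1 u -> E2 v -> 0 < L ->
  (forall y, (E1 `|` E2) y -> gamma (phi y)) ->
  (forall y z, (E1 `|` E2) y -> (E1 `|` E2) z -> d (phi y) (phi z) <= L * d y z) ->
  (forall y z, E1 y -> E2 z -> phi y = phi z -> phi y = phi x) ->
  d (phi u) (phi v) < k -> d (phi u) (phi x) < e /\ d (phi v) (phi x) < e.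
Proof.
move=> e0; have [h [hc hi]] := arc_parametrization H.
have hinj y z : gamma y -> gamma z -> h y = h z -> y = z.
  exact: parametrization_inj hi y z.
have [k k0 kP] := hi _ e0; have [r r0 rP] := hc _ k0.
exists r => // E1 E2 phi L x u v c1 c2 x1 x2 u1 v2 L0 gphi lip inj uv.
have uc E : E `<=` E1 `|` E2 -> eucl_unif_continuous_on E (h \o phi).
  move=> EE s s0; have [m m0 mP] := hc _ s0; exists (m / L); first exact: divr_gt0.
  move=> y z /EE Ey /EE Ez yz /=; apply: mP; [exact: gphi..|].
  by apply: le_lt_trans (lip _ _ Ey Ez) _; rewrite mulrC -ltr_pdivlMr.
have gu : gamma (phi u) by apply: gphi; left.
have gv : gamma (phi v) by apply: gphi; right.
have gx : gamma (phi x) by apply: gphi; left.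
have huv := rP _ _ gu gv uv.
have [] := connected_between E1 E2 (h \o phi) x u v c1 c2 (uc _ _) (uc _ _)
  x1 x2 u1 v2 _.
- by left.
- by right.
- move=> y z y1 z2 /= hyz; congr h; apply: (inj y z y1 z2).
  by apply: hinj hyz; apply: gphi; [left|right].
- by move=> /= between; split; apply: kP => //; move: huv; rewrite !ltr_norml; lra.
- by move=> /= between; split; apply: kP => //; move: huv; rewrite !ltr_norml; lra.
Qed.

(** * Bounded turning in terms of junction separation *)

Lemma bounded_turning_junction : bounded_turning gamma ->
  exists2 kappa, 0 < kappa & junction_separated kappa.
Proof.
move=> [C [C1 BT]]; have C0 : 0 < C by lra.
(* A continuum through the junction bounds each of the two legs by [C] times the distance; their sum
   gives [2 * C]. *)
exists (2 * C)^-1; first by rewrite invr_gt0 mulr_gt0.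
move=> i iN z w gz gw; have iN' := ltnW iN.
rewrite ler_pdivrMl ?mulr_gt0 //; set x := S i b.
have xE1 : (S i @` gamma) x by exists b => //; exact: arc_b H.
have xE2 : (S i.+1 @` gamma) x.
  by exists a; [exact: arc_a H|rewrite /x (Sab H)].
have zE1 : (S i @` gamma) (S i z) by exists z.
have wE2 : (S i.+1 @` gamma) (S i.+1 w) by exists w.
have g1 := piece_sub i iN' _ zE1; have g2 := piece_sub i.+1 iN _ wE2.
have gx := piece_sub i iN' _ xE1.
have [zw|zw] := pselect (S i z = S i.+1 w).
  have zx : S i z = x by apply: adjacent_meet => //; rewrite zw.
  by rewrite -zw zx eucl_distxx addr0 mulr0.
have [E [Eg [_ [nE _]] Ez Ew dE]] := BT _ _ g1 g2 zw.
(* [h x] lies between the values of [h] at the two points, so [h] takes it on [E], and injectivity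
   puts [x] in [E]. *)
have Ex : E x.
  have [h [hc hi]] := arc_parametrization H.
  have uc F : F `<=` gamma -> eucl_unif_continuous_on F h.
    move=> Fg s s0; have [r r0 rP] := hc _ s0; exists r => // y y' /Fg gy /Fg gy'.
    exact: rP.
  have [_ [n1 _]] := piece_continuum i iN'; have [_ [n2 _]] := piece_continuum _ iN.
  suff [t Et tx] : exists2 t, E t & h t = h x.
    by rewrite -(parametrization_inj h hi t x (Eg _ Et) gx tx).
  have inj y y' : (S i @` gamma) y -> (S i.+1 @` gamma) y' -> h y = h y' ->
      h y = h x.
    move=> yE1 yE2 /(parametrization_inj h hi) yy.
    congr h; apply: adjacent_meet => //.
    by rewrite yy //; [exact: piece_sub yE1|exact: piece_sub yE2].
  have [] := connected_between _ _ h x _ _ n1 n2 (uc _ (piece_sub i iN'))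
    (uc _ (piece_sub _ iN)) xE1 xE2 zE1 wE2 inj.
  - exact: connected_ivt nE (uc _ Eg) Ez Ew.
  - exact: connected_ivt nE (uc _ Eg) Ew Ez.
have dub y y' : E y -> E y' -> d y y' <= C * d (S i z) (S i.+1 w).
  move=> Ey Ey'; apply: le_trans dE; apply: (diam_ub _ D) => // u u' /Eg gu /Eg gu'.
  exact/ltW/(arc_diam H).
by have := dub _ _ Ez Ex; have := dub _ _ Ew Ex; lra.
Qed.

Lemma junction_bounded_turning kappa : 0 < kappa -> junction_separated kappa ->
  bounded_turning gamma.
Proof.
move=> k0 J; have D0 := D_gt0 H; have dl0 := delta_gt0 H.
pose M := D / delta; have M0 : 0 < M by exact: divr_gt0.
(* [M] serves when the points are at least [delta] apart, [2 * M / kappa] when they are joined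
   through a junction. *)
pose C := M + 2 * M / kappa.
have Mk0 : 0 < 2 * M / kappa by apply: divr_gt0 => //; exact: mulr_gt0.
have C0 : 0 < C by exact: addr_gt0.
suff key : forall t, 0 < t -> forall p q, gamma p -> gamma q -> d p q = t ->
    exists E, [/\ E `<=` gamma, continuum E, E p, E q &
      forall y z, E y -> E z -> d y z <= C * t].
  exists (C + 1); split; first by lra.
  move=> p q gp gq pq.
  have d0 : 0 < d p q.
    rewrite lt_neqAle dge0 andbT; apply/negP => /eqP/esym.
    by move=> /eucl_dist_eq0.
  have [E [Eg cE Ep Eq Ed]] := key _ d0 p q gp gq erefl.
  exists E; split => //; apply: diam_le; first by exists p.
  by move=> y z Ey Ez; have := Ed y z Ey Ez; lra.
apply: (scale_ind cmax delta) => //; [exact: cmax_gt0 H|exact: cmax_lt1 H|].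
move=> t t0 IH p q gp gq pqt; have [td|dt] := ltP t delta; last first.
  exists gamma; split => //; first exact: arc_continuum H.
  move=> y z gy gz; apply: le_trans (ltW (arc_diam H _ _ gy gz)) _.
  have : 0 <= 2 * M / kappa * t by apply/ltW/mulr_gt0.
  have : D <= M * t by rewrite mulrAC ler_pdivlMr // ler_pM2l.
  rewrite /C; lra.
have [i [z [iN gz pz]]] := arcE H p gp; have [j [w [jN gw qw]]] := arcE H q gq.
(* Two continua run from the points to the junction; separation bounds their sizes by the distance
   of the points. *)
have adj i' z' w' : (i'.+1 < N)%N -> gamma z' -> gamma w' ->
    d (S i' z') (S i'.+1 w') = t -> exists E, [/\ E `<=` gamma, continuum E,
      E (S i' z'), E (S i'.+1 w') & forall y z, E y -> E z -> d y z <= C * t].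
  move=> {z w gz gw pz qw i j iN jN} jN gz gw zwt; have iN := ltnW jN.
  have [E1 [E1g cE1 E1z E1b E1d]] := continuum_at_b z' gz.
  have [E2 [E2g cE2 E2w E2a E2d]] := continuum_at_a w' gw.
  have [cF1 [nF1 _]] := continuum_image H i' E1 iN cE1.
  have [cF2 [nF2 _]] := continuum_image H i'.+1 E2 jN cE2.
  set x := S i' b; have xa : x = S i'.+1 a by exact: Sab H _ jN.
  have := J i' jN z' w' gz gw; rewrite zwt -/x => Jzw.
  have near y : (S i' @` E1 `|` S i'.+1 @` E2) y ->
      d y x <= M * (d (S i' z') x + d (S i'.+1 w') x).
    move=> [] [e Ee <-].
    - have := E1d e Ee; rewrite -(ler_pM2l (c_gt0 H i' iN)) mulrCA -!(distS H) // -/x.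
      by move=> h; apply: le_trans h _; rewrite ler_pM2l // lerDl.
    - have := E2d e Ee; rewrite -(ler_pM2l (c_gt0 H i'.+1 jN)) mulrCA -!(distS H) // -xa.
      by move=> h; apply: le_trans h _; rewrite ler_pM2l // lerDr.
  exists (S i' @` E1 `|` S i'.+1 @` E2); split.
  - by move=> _ [] [e Ee <-]; [exact: arcS H _ _ iN (E1g _ Ee)|exact: arcS H _ _ jN (E2g _ Ee)].
  - split; first exact: compactU; split; last by exists (S i' z'); left; exists z'.
    apply: connectedU => //; exists x; split; first by exists b.
    by exists a.
  - by left; exists z'.
  - by right; exists w'.
  - move=> y y' /near yx /near yx'; apply: le_trans (eucl_dist_triangle x _ _) _.
    rewrite [d x y']eucl_distC.
    have : M * (kappa * (d (S i' z') x + d (S i'.+1 w') x)) <= M * t.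
      by rewrite ler_pM2l.
    rewrite mulrCA -ler_pdivlMl // => h.
    have : 0 <= M * t by rewrite ltW // mulr_gt0.
    have -> : C * t = M * t + 2 * (kappa^-1 * (M * t)) by rewrite /C; ring.
    lra.
have [|ij|ij|ij] := same_or_adjacent i j z w iN jN gz gw; first by rewrite -pz -qw pqt.
- subst j; have [s0 ts] := scale_step H i t iN t0; have ci := c_gt0 H i iN.
  have [|E [Eg cE Ez Ew Ed]] := IH td _ ts z w gz gw.
    by rewrite -pqt pz qw (distS H) // mulrAC mulfV ?mul1r // lt0r_neq0.
  exists (S i @` E); split.
  - by move=> _ [e /Eg ge <-]; exact: arcS H _ _ iN ge.
  - exact: continuum_image H _ _ iN cE.
  - by rewrite pz; exists z.
  - by rewrite qw; exists w.
  - move=> _ _ [y Ey <-] [y' Ey' <-]; rewrite (distS H) // mulrC -ler_pdivlMr //.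
    by rewrite -mulrA; exact: Ed.
- subst j; rewrite pz qw; apply: adj => //; by rewrite -pz -qw.
- subst i; have [|E [Eg cE Ew Ez Ed]] := adj j w z iN gw gz.
    by rewrite eucl_distC -pz -qw.
  by exists E; rewrite pz qw; split.
Qed.

(** * Rescaling maps and junction separation *)

Lemma rescaling_junction (r0 C1 C2 : R) : 0 < r0 -> 0 < C1 -> 0 < C2 ->
  (forall U : set 'rV[R]_n, open U -> U `&` gamma !=set0 ->
     0 < diam (U `&` gamma) -> diam (U `&` gamma) < r0 ->
     exists phi : 'rV[R]_n -> 'rV[R]_n,
       (forall x, (U `&` gamma) x -> gamma (phi x)) /\
       (forall x y, (U `&` gamma) x -> (U `&` gamma) y ->
          C1 * d x y / diam (U `&` gamma) <= d (phi x) (phi y) /\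
          d (phi x) (phi y) <= C2 * d x y / diam (U `&` gamma))) ->
  exists2 kappa, 0 < kappa & junction_separated kappa.
Proof.
move=> r00 C10 C20 maps; have D0 := D_gt0 H; have dl0 := delta_gt0 H.
pose M := D / delta; have M0 : 0 < M by exact: divr_gt0.
have M8 : 0 < 8 * M by exact: mulr_gt0.
(* [bound1] is for [phi] at small scales, [bound2] for the identity at large ones. *)
have [e1 e10 bound1] := cross_junction_bound (C1 / (8 * M)) (divr_gt0 C10 M8).
have [e2 e20 bound2] := cross_junction_bound (r0 / (8 * M)) (divr_gt0 r00 M8).
have k10 : 0 < e1 / (2 * C2) by apply: divr_gt0 => //; exact: mulr_gt0.
have k20 : 0 < e2 / (2 * D) by apply: divr_gt0 => //; exact: mulr_gt0.
exists (Num.min (e1 / (2 * C2)) (e2 / (2 * D))); first by rewrite lt_min k10.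
move=> i iN z w gz gw; have iN' := ltnW iN; set x := S i b.
have xa : x = S i.+1 a by exact: Sab H _ iN.
set s := d (S i z) x + d (S i.+1 w) x.
suff : e1 / (2 * C2) * s <= d (S i z) (S i.+1 w) \/
       e2 / (2 * D) * s <= d (S i z) (S i.+1 w).
  have s0 : 0 <= s by exact: addr_ge0.
  by case; apply: le_trans; rewrite ler_wpM2r // ge_min lexx ?orbT.
have gSz : gamma (S i z) by exact: arcS H _ _ iN' gz.
have gSw : gamma (S i.+1 w) by exact: arcS H _ _ iN gw.
have gx : gamma x by exact: arcS H _ _ iN' (arc_b H).
have [s0|s0] := ltP 0 s; last first.
  left; apply: le_trans (dge0 _ _); rewrite pmulr_rle0 //.
have s2 : s / 2 <= d (S i z) x \/ s / 2 <= d (S i.+1 w) x.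
  have [h|h] := lerP (s / 2) (d (S i z) x); first by left.
  by right; rewrite /s in h *; lra.
(* [4 * M * s] bounds the diameter of the set to be rescaled. If it reaches [r0], the whole pieces
   and the identity are used instead. *)
have [big|small] := lerP r0 (4 * M * s).
  right; have [_ [n1 _]] := piece_continuum i iN'.
  have [_ [n2 _]] := piece_continuum _ iN.
  have e2d : e2 <= d (S i z) (S i.+1 w).
    rewrite leNgt; apply/negP => zw.
    have [||||||||h1 h2] := bound2 _ _ id 1 x (S i z) (S i.+1 w) n1 n2 _ _ _ _ _ _ _ _ zw.
    - by exists b => //; exact: arc_b H.
    - by exists a => //; exact: arc_a H.
    - by exists z.
    - by exists w.
    - exact: ltr01.
    - by move=> y [] /piece_sub; apply.
    - by move=> y y' _ _; rewrite mul1r.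
    - by move=> y y' y1 y2 yy; apply: adjacent_meet => //; rewrite yy.
    have : r0 / (8 * M) <= s / 2.
      by rewrite ler_pdivrMr //; lra.
    rewrite /= in h1 h2; case: s2; lra.
  have sD : s <= 2 * D.
    by have := arc_diam H _ _ gSz gx; have := arc_diam H _ _ gSw gx; rewrite /s; lra.
  apply: le_trans e2d; rewrite mulrAC ler_pdivrMr ?mulr_gt0 //.
  by rewrite ler_pM2l.
left.
have [E1 [E1g cE1 E1z E1b E1d]] := continuum_at_b z gz.
have [E2 [E2g cE2 E2w E2a E2d]] := continuum_at_a w gw.
have [cF1 [nF1 _]] := continuum_image H i E1 iN' cE1.
have [cF2 [nF2 _]] := continuum_image H i.+1 E2 iN cE2.
have near y : (S i @` E1 `|` S i.+1 @` E2) y -> gamma y /\ d y x <= M * s.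
  move=> [] [e Ee <-].
  - split; first exact: arcS H _ _ iN' (E1g _ Ee).
    have := E1d e Ee; rewrite -(ler_pM2l (c_gt0 H i iN')) mulrCA -!(distS H) // -/x.
    by move=> h; apply: le_trans h _; rewrite ler_pM2l // lerDl.
  - split; first exact: arcS H _ _ iN (E2g _ Ee).
    have := E2d e Ee; rewrite -(ler_pM2l (c_gt0 H i.+1 iN)) mulrCA -!(distS H) // -xa.
    by move=> h; apply: le_trans h _; rewrite ler_pM2l // lerDr.
have Ms : 0 < M * s by exact: mulr_gt0.
(* The continua lie within [M * s] of the junction, hence in [U]; so [U] meets [gamma] in a set of
   diameter between [s / 2] and [4 * M * s]. *)
pose U := eball x (2 * (M * s)).
have inU y : (S i @` E1 `|` S i.+1 @` E2) y -> (U `&` gamma) y.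
  by move=> /near[gy yx]; split => //; rewrite /U /eball /= eucl_distC; lra.
have zU : (U `&` gamma) (S i z) by apply: inU; left; exists z.
have wU : (U `&` gamma) (S i.+1 w) by apply: inU; right; exists w.
have xU : (U `&` gamma) x by apply: inU; left; exists b.
have Ud : diam (U `&` gamma) <= 4 * M * s.
  apply: diam_le; first by exists x.
  move=> y y' [Uy _] [Uy' _]; apply: le_trans (eucl_dist_triangle x _ _) _.
  by rewrite [d y x]eucl_distC; rewrite /U /eball /= in Uy Uy'; lra.
have Ub := diam_ub (U `&` gamma) D (fun y y' Uy Uy' =>
  ltW (arc_diam H y y' Uy.2 Uy'.2)).
have sU : s / 2 <= diam (U `&` gamma).
  by case: s2 => h; apply: le_trans h _; exact: Ub.
have U0 : 0 < diam (U `&` gamma) by lra.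
have [|||phi [gphi phiP]] := maps U _ _ U0 _; first exact: eball_open.
- by exists x.
- exact: le_lt_trans Ud small.
set t := diam (U `&` gamma) in Ud U0 sU phiP Ub.
have e1d : e1 <= d (phi (S i z)) (phi (S i.+1 w)).
  rewrite leNgt; apply/negP => zw.
  have [||||||||h1 h2] := bound1 _ _ phi (C2 / t) x (S i z) (S i.+1 w) nF1 nF2 _ _ _ _ _ _ _ _ zw.
  - by exists b.
  - by exists a.
  - by exists z.
  - by exists w.
  - exact: divr_gt0.
  - by move=> y /inU /gphi.
  - by move=> y y' /inU Uy /inU Uy'; rewrite mulrAC; have [] := phiP y y' Uy Uy'.
  (* The lower bound makes [phi] injective, so the images of the two continua meet only at
     [phi x]. *)
  - move=> y y' y1 y2 yy; congr phi.
    have Uy := inU y (or_introl y1); have Uy' := inU y' (or_intror y2).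
    have [+ _] := phiP y y' Uy Uy'; rewrite yy eucl_distxx ler_pdivrMr // mul0r.
    rewrite pmulr_rle0 // => d0.
    have yy' : y = y' by apply: eucl_dist_eq0; apply/eqP; rewrite eq_le d0 dge0.
    apply: adjacent_meet => //.
      by case: y1 => e /E1g ge <-; exists e.
    by rewrite yy'; case: y2 => e /E2g ge <-; exists e.
  (* The lower bound gives [C1 * (s / 2) / (4 * M * s)], exactly the threshold that [bound1] was
     given. *)
  have far y : (U `&` gamma) y -> s / 2 <= d y x -> C1 / (8 * M) <= d (phi y) (phi x).
    move=> Uy yx; have [+ _] := phiP y x Uy xU; apply: le_trans.
    rewrite ler_pdivlMr // mulrAC ler_pdivrMr // -mulrA ler_pM2l //.
    have : (s / 2) * (8 * M) <= d y x * (8 * M) by rewrite ler_pM2r.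
    lra.
  by case: s2 => /far; [move=> /(_ zU)|move=> /(_ wU)]; lra.
have [_ up] := phiP _ _ zU wU.
have := le_trans e1d up; rewrite ler_pdivlMr // => h.
rewrite mulrAC ler_pdivrMr ?mulr_gt0 //.
have : e1 * (s / 2) <= e1 * t by rewrite ler_pM2l.
lra.
Qed.

(* [phi] blows up both sides of the junction by comparable factors; junction
   separation makes the distance across a junction comparable to the sum of
   the distances to it, both in the source and in the image. *)
Lemma junction_rescale kappa i T : 0 < kappa -> kappa <= 1 ->
  junction_separated kappa -> (i.+1 < N)%N -> 0 < T -> T <= cmin * delta ->
  exists phi : 'rV[R]_n -> 'rV[R]_n,
  (forall y, (S i @` gamma `|` S i.+1 @` gamma) y -> d y (S i b) <= T ->
     gamma (phi y)) /\
  (forall y y', (S i @` gamma `|` S i.+1 @` gamma) y ->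
     (S i @` gamma `|` S i.+1 @` gamma) y' -> d y (S i b) <= T ->
     d y' (S i b) <= T ->
     kappa * (cmin * delta) * d y y' <= T * d (phi y) (phi y') /\
     kappa * cmin * T * d (phi y) (phi y') <= delta * d y y').
Proof.
move=> k0 k1 J iN T0 Tm; have iN' := ltnW iN; have N2 := arc_N H.
have cm0 := cmin_gt0 H; have dl0 := delta_gt0 H.
have xa : S i b = S i.+1 a by exact: Sab H _ iN.
have ya : S 0%N b = S 1%N a by exact: Sab H _ N2.
(* Both sides are sent to the junction of pieces 0 and 1, which exists since [N] is at least 2. *)
have [f1 [s1 [f1g f1d f1b s1l s1u]]] := rescale_at_b i 0%N T iN' kN0 T0 Tm.
have [f2 [s2 [f2g f2d f2a s2l s2u]]] := rescale_at_a i.+1 1%N T iN N2 T0 Tm.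
rewrite -xa in f2g f2d f2a; rewrite -ya in f2a.
set x := S i b in f1g f1d f1b f2g f2d f2a *.
(* The branches agree at [x], the only common point of the two pieces: both send it to [S 0 b]. *)
pose phi y := if pselect ((S i @` gamma) y) then f1 y else f2 y.
have split_phi y : (S i @` gamma `|` S i.+1 @` gamma) y ->
    (exists2 z, gamma z & y = S i z /\ phi y = f1 y) \/
    (exists2 w, gamma w & y = S i.+1 w /\ phi y = f2 y).
  rewrite /phi; case: pselect => /= [[z gz zy] _|ny]; first by left; exists z.
  by move=> [//|[w gw <-]]; right; exists w.
have bx : d x x <= T by rewrite eucl_distxx ltW.
have kcm : kappa * cmin <= cmin by rewrite ler_piMl // ltW.
(* On one side [phi] is a similarity; [kappa <= 1] weakens its bounds to those of the mixed case. *)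
have same s y y' u u' : cmin * delta <= s * T -> cmin * s * T <= delta ->
    d u u' = s * d y y' ->
    kappa * (cmin * delta) * d y y' <= T * d u u' /\
    kappa * cmin * T * d u u' <= delta * d y y'.
  move=> sl su ->; have s0 : 0 <= s.
    have : 0 < s * T by apply: lt_le_trans sl; exact: mulr_gt0.
    by rewrite pmulr_lgt0 // => /ltW.
  rewrite !mulrA; split; apply: ler_wpM2r => //.
    have : kappa * cmin * delta <= cmin * delta by rewrite ler_pM2r.
    lra.
  have : kappa * (cmin * s * T) <= cmin * s * T.
    by rewrite ler_piMl // !mulr_ge0 // ltW.
  lra.
have cross y y' u u' : cmin * delta <= s1 * T -> cmin * s1 * T <= delta ->
    cmin * delta <= s2 * T -> cmin * s2 * T <= delta ->
    d u (S 0%N b) = s1 * d y x -> d u' (S 0%N b) = s2 * d y' x ->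
    kappa * (d y x + d y' x) <= d y y' ->
    kappa * (d u (S 0%N b) + d u' (S 0%N b)) <= d u u' ->
    kappa * (cmin * delta) * d y y' <= T * d u u' /\
    kappa * cmin * T * d u u' <= delta * d y y'.
  move=> _ _ _ _ ux u'x Jy Ju.
  have ty : d y y' <= d y x + d y' x.
    by rewrite [d y' x]eucl_distC; exact: eucl_dist_triangle.
  have tu : d u u' <= s1 * d y x + s2 * d y' x.
    by rewrite -ux -u'x [d u' _]eucl_distC; exact: eucl_dist_triangle.
  rewrite ux u'x in Ju; split.
    have h1 : T * (kappa * (s1 * d y x + s2 * d y' x)) <= T * d u u'.
      by rewrite ler_pM2l.
    apply: le_trans h1.
    have h2 : kappa * (cmin * delta) * d y y' <=
        kappa * (cmin * delta) * (d y x + d y' x).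
      by rewrite ler_pM2l ?mulr_gt0.
    have h3 : cmin * delta * (d y x + d y' x) <= T * (s1 * d y x + s2 * d y' x).
      have := ler_wpM2r (dge0 y x) s1l; have := ler_wpM2r (dge0 y' x) s2l.
      lra.
    have := ler_wpM2l (ltW k0) h3; lra.
  have h1 : kappa * cmin * T * d u u' <=
      kappa * cmin * T * (s1 * d y x + s2 * d y' x).
    by rewrite ler_pM2l ?mulr_gt0.
  apply: le_trans h1 _.
  have h2 : delta * (kappa * (d y x + d y' x)) <= delta * d y y'.
    by rewrite ler_pM2l.
  have h3 : cmin * T * (s1 * d y x + s2 * d y' x) <= delta * (d y x + d y' x).
    have := ler_wpM2r (dge0 y x) s1u; have := ler_wpM2r (dge0 y' x) s2u.
    lra.
  have := ler_wpM2l (ltW k0) h3; lra.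
have crossP z w : gamma z -> gamma w -> d (S i z) x <= T -> d (S i.+1 w) x <= T ->
    kappa * (cmin * delta) * d (S i z) (S i.+1 w) <=
      T * d (f1 (S i z)) (f2 (S i.+1 w)) /\
    kappa * cmin * T * d (f1 (S i z)) (f2 (S i.+1 w)) <=
      delta * d (S i z) (S i.+1 w).
  move=> gz gw zT wT; apply: cross => //.
  - by rewrite -f1b f1d //; exact: arc_b H.
  - have ax : S i.+1 a = x by exact: esym xa.
    by rewrite -f2a -ax f2d ?ax //; exact: arc_a H.
  - exact: J.
  - have [z' gz' ->] := f1g z gz zT; have [w' gw' ->] := f2g w gw wT.
    exact: J.
exists phi; split.
  move=> y /split_phi[[z gz [yz ->]]|[w gw [yw ->]]] yT; subst y.
    by have [z' gz' ->] := f1g z gz yT; exact: arcS H _ _ kN0 gz'.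
  by have [w' gw' ->] := f2g w gw yT; exact: arcS H _ _ N2 gw'.
move=> y y' /split_phi[[z gz [yz ->]]|[w gw [yw ->]]]
  /split_phi[[z' gz' [yz' ->]]|[w' gw' [yw' ->]]] yT yT'; subst y y'.
- by apply: (same s1) => //; exact: f1d.
- exact: crossP.
- by rewrite [d (S _ _) _]eucl_distC [d (f2 _) _]eucl_distC; exact: crossP.
- by apply: (same s2) => //; exact: f2d.
Qed.

(** Arbitrary subsets and a scale [t] between [diam A] and [2 * diam A] form a setting stable under
    preimages by the [S i], so that induction on scale applies. *)
Lemma junction_rescaling kappa : 0 < kappa -> junction_separated kappa ->
  exists C1 C2, [/\ 0 < C1, 0 < C2 & forall t, 0 < t -> forall A : set 'rV[R]_n,
    A `<=` gamma -> (forall x y, A x -> A y -> d x y <= t) ->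
    (exists x y, [/\ A x, A y & t <= 2 * d x y]) ->
    exists phi : 'rV[R]_n -> 'rV[R]_n, (forall x, A x -> gamma (phi x)) /\
      (forall x y, A x -> A y -> C1 * d x y / t <= d (phi x) (phi y) /\
         d (phi x) (phi y) <= C2 * d x y / t)].
Proof.
move=> k0' J'; have [kappa1 [k0 k1 J]] : exists k, [/\ 0 < k, k <= 1 & junction_separated k].
  exists (Num.min kappa 1); split.
  - by rewrite lt_min k0' ltr01.
  - by rewrite ge_min lexx orbT.
  - move=> i iN z w gz gw; apply: le_trans (J' i iN z w gz gw).
    by rewrite ler_wpM2r ?addr_ge0 // ge_min lexx.
move: kappa1 k0 k1 J => k k0 k1 J {kappa k0' J'}.
have D0 := D_gt0 H; have cm0 := cmin_gt0 H; have dl0 := delta_gt0 H.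
(* [K * t] bounds the distance to the junction: [t] to reach a given point of [A] in piece [i], then
   [t / k] by separation. *)
pose K := 1 + k^-1; have kV : 0 < k^-1 by rewrite invr_gt0.
have K0 : 0 < K by rewrite /K; lra.
pose eta := cmin * delta / K.
have eta0 : 0 < eta by apply: divr_gt0 => //; exact: mulr_gt0.
(* The first term comes from [junction_rescale] at scale [K * t]; the second admits the identity,
   since [t < 2 * D]. *)
pose C2 := delta / (k * cmin * K) + 2 * D.
have C20' : 0 < delta / (k * cmin * K) by rewrite divr_gt0 ?mulr_gt0.
have C20 : 0 < C2 by rewrite /C2; lra.
exists (k * eta), C2; split => //; first exact: mulr_gt0.
apply: (scale_ind cmax delta) => //; [exact: cmax_gt0 H|exact: cmax_lt1 H|].
move=> t t0 IH A Ag At [x0 [y0 [Ax0 Ay0 txy]]].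
have t2D : t < 2 * D by have := arc_diam H _ _ (Ag _ Ax0) (Ag _ Ay0); lra.
have [big|small] := leP eta t.
  exists id; split; first exact: Ag.
  move=> x y _ _; have dxy := dge0 x y; split.
    rewrite ler_pdivrMr // mulrC; apply: ler_wpM2l => //.
    by apply: le_trans big; rewrite ler_piMl // ltW.
  rewrite ler_pdivlMr // mulrC; apply: ler_wpM2r => //.
  by rewrite /C2; lra.
have KE : K * eta = cmin * delta by rewrite mulrC divfK // lt0r_neq0.
have KT : K * t <= cmin * delta by rewrite -KE ler_pM2l // ltW.
have cm1 : cmin < 1.
  by have := c_bounds H 0%N kN0; have := cmax_lt1 H; lra.
have td : t < delta.
  have : t < K * t by rewrite ltr_pMl // /K; lra.
  have : cmin * delta < delta by rewrite gtr_pMl.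
  lra.
have adjacent i z w : (i.+1 < N)%N -> gamma z -> gamma w -> A (S i z) ->
    A (S i.+1 w) -> exists phi : 'rV[R]_n -> 'rV[R]_n,
    (forall x, A x -> gamma (phi x)) /\
    (forall x y, A x -> A y -> k * eta * d x y / t <= d (phi x) (phi y) /\
       d (phi x) (phi y) <= C2 * d x y / t).
  move=> iN gz gw Az Aw; have iN' := ltnW iN.
  have cover y : A y -> (S i @` gamma `|` S i.+1 @` gamma) y.
    move=> Ay; have [j [u [jN gu yu]]] := arcE H y (Ag _ Ay); subst y.
    have zu := le_lt_trans (At _ _ Ay Az) td.
    have wu := le_lt_trans (At _ _ Ay Aw) td.
    have ji := same_or_adjacent j i u z jN iN' gu gz zu.
    have ji' := same_or_adjacent j i.+1 u w jN iN gu gw wu.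
    have [->|->] : j = i \/ j = i.+1 by clear -ji ji'; case: ji; case: ji'; lia.
    - by left; exists u.
    - by right; exists u.
  have near y : A y -> d y (S i b) <= K * t.
    move=> Ay; apply: le_trans (eucl_dist_triangle (S i z) _ _) _.
    rewrite /K mulrDl mul1r; apply: lerD; first exact: At.
    rewrite -ler_pdivrMl ?invr_gt0 // invrK.
    have := J i iN z w gz gw; have := At _ _ Az Aw.
    have : 0 <= k * d (S i.+1 w) (S i b) by rewrite mulr_ge0 // ltW.
    lra.
  have KT0 : 0 < K * t by exact: mulr_gt0.
  have [phi [gphi phiP]] := junction_rescale k i (K * t) k0 k1 J iN KT0 KT.
  exists phi; split; first by move=> y Ay; apply: gphi; [exact: cover|exact: near].
  move=> x y Ax Ay.
  have [lo up] := phiP x y (cover x Ax) (cover y Ay) (near x Ax) (near y Ay).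
  split.
    rewrite ler_pdivrMr // -(ler_pM2l K0).
    have -> : K * (k * eta * d x y) = k * (cmin * delta) * d x y.
      by rewrite -KE; ring.
    lra.
  have kcK : 0 < k * cmin * K by rewrite !mulr_gt0.
  rewrite ler_pdivlMr //.
  apply: (@le_trans _ _ (delta / (k * cmin * K) * d x y)).
    rewrite mulrAC ler_pdivlMr //; lra.
  by apply: ler_wpM2r => //; rewrite /C2; lra.
(* If [A] lies in one piece, its preimage under [S i] has scale [t / c i]. Otherwise, as
   [t < delta], it meets two adjacent pieces. *)
have [[i [iN Ai]]|nA] := pselect (exists i, (i < N)%N /\ A `<=` S i @` gamma).
  have [s0 ts] := scale_step H i t iN t0; have ci := c_gt0 H i iN.
  have [f fK] := S_inverse H i iN.
  have [|||phi [gphi phiP]] := IH td _ ts [set z | gamma z /\ A (S i z)].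
  - by move=> z [].
  - move=> z w [gz Az] [gw Aw]; have := At _ _ Az Aw.
    by rewrite (distS H) // ler_pdivlMr // mulrC.
  - have [z gz zx] := Ai _ Ax0; have [w gw wy] := Ai _ Ay0.
    exists z, w; split; [by rewrite /= zx|by rewrite /= wy|].
    move: txy; rewrite -zx -wy (distS H) // ler_pdivrMr //; lra.
  exists (phi \o f); split.
    move=> x Ax; have [z gz zx] := Ai _ Ax; rewrite -zx /= fK.
    by apply: gphi; rewrite /= zx.
  move=> x y Ax Ay; have [z gz zx] := Ai _ Ax; have [w gw wy] := Ai _ Ay.
  rewrite -zx -wy /= !fK (distS H) //.
  have [||lo up] := phiP z w; [by rewrite /= zx|by rewrite /= wy|].
  have E C : C * (c i * d z w) / t = C * d z w / (t / c i).
    by field; rewrite !lt0r_neq0.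
  by rewrite !E.
have [i [z [iN gz xz]]] := arcE H x0 (Ag _ Ax0).
have [q Aq nq] : exists2 q, A q & ~ (S i @` gamma) q.
  apply: contrapT => nq; apply: nA; exists i; split => // q Aq.
  by apply: contrapT => qi; apply: nq; exists q.
have [j [w [jN gw qw]]] := arcE H q (Ag _ Aq); subst x0 q.
have [|ij|ij|ij] := same_or_adjacent i j z w iN jN gz gw.
- exact: le_lt_trans (At _ _ Ax0 Aq) td.
- by case: nq; exists w => //; rewrite ij.
- by subst j; apply: adjacent Ax0 Aq.
- by subst i; apply: adjacent Aq Ax0.
Qed.

End BoundedTurning.

(** * Small copies of the arc in balls *)

(** Similarities are undone around [x] until the radius reaches [D], where all of [gamma] fits in
    the ball and the identity serves. *)
Lemma arc_small_copies {R : realType} {n N : nat}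
    {S : nat -> 'rV[R]_n -> 'rV[R]_n} {gamma : set 'rV[R]_n}
    {a b : 'rV[R]_n} {c : nat -> R} {cmin cmax D delta : R} :
  @arc_data R n N S gamma a b c cmin cmax D delta ->
  exists r1 C3 : R, [/\ 0 < r1, 0 < C3 &
    forall x r, gamma x -> 0 < r -> r < r1 ->
      exists psi : 'rV[R]_n -> 'rV[R]_n,
        (forall y, gamma y -> (eball x r `&` gamma) (psi y)) /\
        (forall y z, gamma y -> gamma z ->
           C3 * r * eucl_dist y z <= eucl_dist (psi y) (psi z))].
Proof.
move=> H; have D0 := D_gt0 H; have cm0 := cmin_gt0 H.
have C30 : 0 < cmin / D by exact: divr_gt0.
exists D, (cmin / D); split => //.
have cm1 : cmin <= 1.
  have N0 : (0 < N)%N by have := arc_N H; lia.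
  by have := c_bounds H 0%N N0; have := cmax_lt1 H; lra.
have DC : cmin / D * (D / cmin) = 1 by field; rewrite !lt0r_neq0.
(* The bound [r <= D / cmin] persists, as [r < D] and [cmin <= c i]; it makes [cmin / D * r] at most
   1 when the identity is used. *)
suff key : forall r, 0 < r -> r <= D / cmin -> forall x, gamma x ->
    exists psi : 'rV[R]_n -> 'rV[R]_n,
      (forall y, gamma y -> (eball x r `&` gamma) (psi y)) /\
      (forall y z, gamma y -> gamma z ->
         cmin / D * r * eucl_dist y z <= eucl_dist (psi y) (psi z)).
  move=> x r gx r0 rD; apply: key => //; apply: le_trans (ltW rD) _.
  by rewrite ler_pdivlMr // ler_piMr // ltW.
apply: (scale_ind cmax D) => //; [exact: cmax_gt0 H|exact: cmax_lt1 H|].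
move=> r r0 IH rmax x gx; have [rD|Dr] := ltP r D; last first.
  exists id; split => [y gy|y z gy gz].
    by split => //; apply: lt_le_trans (arc_diam H _ _ gx gy) Dr.
  rewrite ler_piMl ?eucl_dist_ge0 // -DC ler_pM2l //.
have [i [u [iN gu xu]]] := arcE H x gx; subst x.
have [s0 rs] := scale_step H i r iN r0; have ci := c_gt0 H i iN.
have [mi _] := andP (c_bounds H i iN).
have [|psi [psig psid]] := IH rD _ rs _ u gu.
  rewrite ler_pdivrMr // mulrAC ler_pdivlMr //; apply: ler_pM => //; exact: ltW.
exists (S i \o psi); split => [y gy|y z gy gz].
  have [near gpsi] := psig y gy; split; last exact: arcS H _ _ iN gpsi.
  by rewrite /eball /= (distS H) // mulrC -ltr_pdivlMr.
rewrite /= (distS H) //.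
have -> : cmin / D * r * eucl_dist y z = c i * (cmin / D * (r / c i) * eucl_dist y z).
  by field; rewrite !lt0r_neq0.
by rewrite ler_pM2l //; exact: psid.
Qed.

Theorem theorem5p6 (R : realType) (n N : nat)
  (S : nat -> 'rV[R]_n -> 'rV[R]_n) (gamma : set 'rV[R]_n) :
  IFS_arc N S gamma ->
  (bounded_turning gamma <->
   ((exists r0 C1 C2 : R, [/\ 0 < r0, 0 < C1, 0 < C2 &
       forall U : set 'rV[R]_n, open U -> U `&` gamma !=set0 ->
         0 < diam (U `&` gamma) -> diam (U `&` gamma) < r0 ->
         exists phi : 'rV[R]_n -> 'rV[R]_n,
           (forall a, (U `&` gamma) a -> gamma (phi a)) /\
           (forall a b, (U `&` gamma) a -> (U `&` gamma) b ->
              C1 * eucl_dist a b / diam (U `&` gamma) <= eucl_dist (phi a) (phi b) /\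
              eucl_dist (phi a) (phi b) <= C2 * eucl_dist a b / diam (U `&` gamma))])
    /\
    (exists r1 C3 : R, [/\ 0 < r1, 0 < C3 &
       forall x r, gamma x -> 0 < r -> r < r1 ->
         exists psi : 'rV[R]_n -> 'rV[R]_n,
           (forall a, gamma a -> (eball x r `&` gamma) (psi a)) /\
           (forall a b, gamma a -> gamma b ->
              C3 * r * eucl_dist a b <= eucl_dist (psi a) (psi b))]))).
Proof.
move=> arc; have [[p ->]|[a [b [c [cmin [cmax [D [delta H]]]]]]]] := IFS_arc_data arc.
  (* One-point [gamma]: no distinct points, no positive diameter, and the identity maps it into
     every ball about it. *)
  split=> [_|_]; last first.
    by exists 1; split => // x y -> -> /(_ erefl).
  split.
    exists 1, 1, 1; split => // U _ U0; rewrite ltNge => /negP[].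
    by apply: diam_le => // x y [_ ->] [_ ->]; rewrite eucl_distxx.
  exists 1, 1; split => // x r -> r0 _; exists id.
  split => [y ->|y z -> ->]; last by rewrite eucl_distxx mulr0.
  by split => //; rewrite /eball /= eucl_distxx.
split=> [BT|[[r0 [C1 [C2 [r00 C10 C20 maps]]]] _]].
  have [kappa k0 J] := bounded_turning_junction H BT.
  have [C1 [C2 [C10 C20 maps]]] := junction_rescaling H kappa k0 J.
  split; last exact: arc_small_copies H.
  (* [r0 = 1] is arbitrary, as the maps exist for every positive diameter; the diameter itself
     serves as the scale. *)
  exists 1, C1, C2; split => // U _ U0 d0 _.
  have bd x y : (U `&` gamma) x -> (U `&` gamma) y -> eucl_dist x y <= D.
    by move=> [_ gx] [_ gy]; exact/ltW/(arc_diam H).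
  apply: maps => //; first exact: diam_ub bd.
  exact: diam_half bd d0.
have [kappa k0 J] := rescaling_junction H r0 C1 C2 r00 C10 C20 maps.
exact: junction_bounded_turning H kappa k0 J.
Qed.
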